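(* Let $\Bbbk$ be a field, let $m\le n$ be positive integers and $q\in\Bbbk^\ast$. The $\Bbbk$-algebra $\mathcal O_q(G_{m,n}(\Bbbk))$ is a symmetric quantum graded algebra with a straightening law on $\Pi_{m,n}$, which satisfies condition (C).
   Context: $\mathcal O_q(M_{n,m}(\Bbbk))$ is the $\Bbbk$-algebra with generators $X_{ij}$, $1\le i\le n$, $1\le j\le m$, and the standard quantum matrix relations: $X_{ij}X_{il}=qX_{il}X_{ij}$ for $j<l$; $X_{ij}X_{kj}=qX_{kj}X_{ij}$ for $i<k$; $X_{il}X_{kj}=X_{kj}X_{il}$ for $i<k$, $j<l$; $X_{ij}X_{kl}-X_{kl}X_{ij}=(q-q^{-1})X_{il}X_{kj}$ for $i<k$, $j<l$. $\Pi_{m,n}\subseteq\mathbb N^m$ is the set of $(i_1,\dots,i_m)$ with $1\le i_1<\dots<i_m\le n$, with the product order of $\mathbb N^m$ (it is a distributive sublattice of $\mathbb N^m$). For $I=(i_1,\dots,i_m)\in\Pi_{m,n}$, $[I]=\sum_{\sigma\in S_m}(-q)^{\ell(\sigma)}X_{i_{1}\sigma(1)}\cdots X_{i_{m}\sigma(m)}$ is the $m\times m$ quantum minor on rows $i_1,\dots,i_m$ and columns $1,\dots,m$. $\mathcal O_q(G_{m,n}(\Bbbk))$ is the $\Bbbk$-subalgebra of $\mathcal O_q(M_{n,m}(\Bbbk))$ generated by all $[I]$, $I\in\Pi_{m,n}$; it is $\mathbb N$-graded with each $[I]$ of degree $1$. The structure map $\Pi_{m,n}\to\mathcal O_q(G_{m,n}(\Bbbk))$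 is $I\mapsto[I]$. Standard monomials: given a map $\iota:\Pi\to A$ from an ordered set (poset) to a ring, the standard monomial attached to a finite increasing sequence $\alpha_1\le\dots\le\alpha_t$ ($t\ge1$) is $\iota(\alpha_1)\cdots\iota(\alpha_t)$; to the empty sequence one attaches $1_A$. Linear independence of standard monomials means that of the family indexed by finite increasing sequences. Symmetric quantum graded algebra with a straightening law (A.S.L.): an $\mathbb N$-graded $\Bbbk$-algebra $A$ with a finite ordered set $(\Pi,\le)$ and a map $\Pi\to A$ whose image consists of homogeneous elements of positive degree generating $A$ as a $\Bbbk$-algebra, such that (i) standard monomials on $\Pi$ are linearly independent (so $\Pi$ is identified with its image in $A$); (ii) for any pair $(\alpha,\beta)$ of incomparable elements of $\Pi$ there is a (necessarily unique) relation, the straightening relation, $\alpha\beta=\sum_{(\lambda,\mu)}c_{\lambda,\mu}^{\alpha,\beta}\lambda\mu$, the sum being over pairs $(\lambda,\mu)\in\Pi^2$ with $\lambda<\alpha,\beta<\mu$ (i.e. $\lambda<\alpha$, $\lambda<\beta$, $\alpha<\mu$, $\beta<\mu$), with $c_{\lambda,\mu}^{\alpha,\beta}\in\Bbbk$; (iii) for any pair $(\alpha,\beta)$ of elements of $\Pi$ there is a relation, called a commutation relation, $\alpha\beta-q_{\alpha\beta}\beta\alpha=\sum_{(\lambda,\mu)}d_{\lambda,\mu}^{\alpha,\beta}\lambda\mu$, the sum being over pairs $(\lambda,\mu)\in\Pi^2$ with $\lambda<\alpha,\beta<\mu$, with $d_{\lambda,\mu}^{\alpha,\beta}\in\Bbbk$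 and $q_{\alpha\beta}\in\Bbbk^\ast$. Condition (C): let $\mathcal C_p=\{1,\dots,p\}$. An element $(i_1,\dots,i_d)\in\mathbb N^d$ is increasing if $i_1\le\dots\le i_d$; $\mathbb N^d$ has the product order. For $I,J\in\mathbb N^d$, $I\sqcup J$ denotes the multiset union of the coordinates of $I$ and of $J$. $A$ satisfies condition (C) if (iv) $(\Pi,\le)$ is a distributive lattice and there exist $d\ge1$, integers $n_1,\dots,n_d\ge2$ and an injective lattice morphism $\iota:\Pi\to\mathcal C_{n_1}\times\dots\times\mathcal C_{n_d}$ whose images are all increasing elements of $\mathbb N^d$; (v) for any incomparable $\alpha,\beta$, in the straightening relation one has $c_{\alpha\wedge\beta,\alpha\vee\beta}^{\alpha,\beta}\ne0$, and $c_{\lambda,\mu}^{\alpha,\beta}\ne0$ implies $\alpha\sqcup\beta=\lambda\sqcup\mu$ (elements of $\Pi$ being identified with their images under $\iota$); (vi) for any $(\alpha,\beta)\in\Pi^2$ there is a commutation relation with $d_{\alpha\wedge\beta,\alpha\vee\beta}^{\alpha,\beta}=0$ and such that $d_{\lambda,\mu}^{\alpha,\beta}\ne0$ implies $\alpha\sqcup\beta=\lambda\sqcup\mu$. *)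

(* Defs.v *)
(* Mathematical Components, with the monoid algebras of multinomials and the
   classical axioms of mathcomp.classical.boolp. *)
From HB Require Import structures.
From mathcomp Require Import all_boot all_order all_algebra all_fingroup.
From mathcomp Require Import generic_quotient ring_quotient.
From mathcomp Require Import boolp.
From mathcomp.multinomials Require Import monalg.

Set Implicit Arguments.
Unset Strict Implicit.
Unset Printing Implicit Defensive.

Import Order.TTheory GRing.Theory.

Local Open Scope ring_scope.

Section Generation.

Definition two_sided_ideal (R : nzRingType) (J : {pred R}) : Prop :=
  zmod_closed J /\
  (forall a x : R, x \in J -> (a * x \in J) /\ (x * a \in J)).

Definition ideal_gen (R : nzRingType) (S : R -> Prop) : {pred R} :=
  fun x => `[< forall J : {pred R}, two_sided_ideal J ->
                 (forall r, S r -> r \in J) -> x \in J >].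

Definition subalg_gen (k : fieldType) (A : algType k) (S : A -> Prop) :
    {pred A} :=
  fun x => `[< forall B : {pred A}, GRing.subalg_closed B ->
                 (forall r, S r -> r \in B) -> x \in B >].

Lemma ideal_genP (R : nzRingType) (S : R -> Prop) :
  two_sided_ideal (ideal_gen S).
Proof.
split; first split.
- by apply/asboolP => J [[J0 _] _] _.
- move=> x y /asboolP Sx /asboolP Sy; apply/asboolP => J idJ SJ.
  by case: (idJ) => -[_ JB] _; apply: JB; [apply: Sx|apply: Sy].
- move=> a x /asboolP Sx; split; apply/asboolP => J idJ SJ;
  by case: (idJ) => _ JM; case: (JM a x (Sx J idJ SJ)).
Qed.

Lemma ideal_gen_zmod (R : nzRingType) (S : R -> Prop) :
  zmod_closed (ideal_gen S).
Proof. by case: (ideal_genP S). Qed.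

HB.instance Definition _ (R : nzRingType) (S : R -> Prop) :=
  GRing.isZmodClosed.Build R (ideal_gen S) (ideal_gen_zmod S).

Lemma subalg_genP (k : fieldType) (A : algType k) (S : A -> Prop) :
  GRing.subalg_closed (subalg_gen S).
Proof.
split.
- by apply/asboolP => B [].
- move=> a x y /asboolP Sx /asboolP Sy; apply/asboolP => B clB SB.
  by case: (clB) => _ BL _; apply: BL; [apply: Sx|apply: Sy].
- move=> x y /asboolP Sx /asboolP Sy; apply/asboolP => B clB SB.
  by case: (clB) => _ _ BM; apply: BM; [apply: Sx|apply: Sy].
Qed.

HB.instance Definition _ (k : fieldType) (A : algType k) (S : A -> Prop) :=
  GRing.isSubalgClosed.Build k A (subalg_gen S) (subalg_genP S).

End Generation.

Section QuantumMatrices.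

Variables (k : fieldType) (n m : nat) (q : k).

(* The free associative algebra on the letters (i, j). *)
Notation freeMat := {malg k[{fmonom ('I_n * 'I_m)%type}]}.

Definition Xfree (i : 'I_n) (j : 'I_m) : freeMat := << fmu (i, j) >>.

(* Rows are indexed by 'I_n and columns by 'I_m, both starting at 0.  The
   relators lhs - rhs of the defining relations lhs = rhs. *)
Inductive qmat_relator : freeMat -> Prop :=
| QMrow (i : 'I_n) (j l : 'I_m) of (j < l)%N :
    qmat_relator (Xfree i j * Xfree i l - q *: (Xfree i l * Xfree i j))
| QMcol (i h : 'I_n) (j : 'I_m) of (i < h)%N :
    qmat_relator (Xfree i j * Xfree h j - q *: (Xfree h j * Xfree i j))
| QManti (i h : 'I_n) (j l : 'I_m) of (i < h)%N & (j < l)%N :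
    qmat_relator (Xfree i l * Xfree h j - Xfree h j * Xfree i l)
| QMdiag (i h : 'I_n) (j l : 'I_m) of (i < h)%N & (j < l)%N :
    qmat_relator (Xfree i j * Xfree h l - Xfree h l * Xfree i j
                  - (q - q^-1) *: (Xfree i l * Xfree h j)).

Definition qmat_ideal : {pred freeMat} := ideal_gen qmat_relator.

HB.instance Definition _ := GRing.ZmodClosed.on qmat_ideal.

Definition OqM : Type := Quotient.quot qmat_ideal.

HB.instance Definition _ := GRing.Zmodule.on OqM.
HB.instance Definition _ : EqQuotient freeMat (Quotient.equiv qmat_ideal) OqM :=
  EqQuotient.on OqM.
HB.instance Definition _ := ZmodQuotient.on OqM.

Local Open Scope quotient_scope.

Lemma qmat_idealM (a x : freeMat) :
  x \in qmat_ideal -> (a * x \in qmat_ideal) /\ (x * a \in qmat_ideal).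
Proof. by case: (ideal_genP qmat_relator) => _; apply. Qed.

Lemma freeMat_scaleAr (c : k) (x y : freeMat) : c *: (x * y) = x * (c *: y).
Proof.
have xC : x * malgC c = c *: x.
  rewrite malgM_def fgmulgU malgZ_def; apply: eq_bigr => w _.
  by rewrite mulm1 mulrC.
by rewrite -[c *: y]mul_malgC mulrA xC scalerAl.
Qed.

Lemma qmat_relator_augmentation (r : freeMat) :
  qmat_relator r -> mcoeff mone r = 0.
Proof.
have X0 i j : mcoeff mone (Xfree i j) = 0.
  rewrite mcoeffU1; case: eqP => // /(congr1 (@fdeg _)).
  by rewrite fdegU fdeg1.
have M0 (x y : freeMat) : mcoeff mone y = 0 -> mcoeff mone (x * y) = 0.
  by move=> y0; rewrite (mcoeff1g_is_multiplicative _ _).1 y0 mulr0.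
have B0 (x y : freeMat) :
    mcoeff mone x = 0 -> mcoeff mone y = 0 -> mcoeff mone (x - y) = 0.
  by move=> x0 y0; rewrite mcoeffB x0 y0 subr0.
have Z0 c (x : freeMat) : mcoeff mone x = 0 -> mcoeff mone (c *: x) = 0.
  by move=> x0; rewrite mcoeffZ x0 mulr0.
case=> [i j l _|i h j _|i h j l _ _|i h j l _ _].
- exact: (B0 _ _ (M0 _ _ (X0 _ _)) (Z0 _ _ (M0 _ _ (X0 _ _)))).
- exact: (B0 _ _ (M0 _ _ (X0 _ _)) (Z0 _ _ (M0 _ _ (X0 _ _)))).
- exact: (B0 _ _ (M0 _ _ (X0 _ _)) (M0 _ _ (X0 _ _))).
- exact: (B0 _ _ (B0 _ _ (M0 _ _ (X0 _ _)) (M0 _ _ (X0 _ _)))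
                 (Z0 _ _ (M0 _ _ (X0 _ _)))).
Qed.

Lemma qmat_ideal1 : 1 \notin qmat_ideal.
Proof.
pose J : {pred freeMat} := [pred x | mcoeff mone x == 0].
have idJ : two_sided_ideal J.
  split; first split.
  - by rewrite inE mcoeff0.
  - by move=> x y; rewrite !inE mcoeffB => /eqP -> /eqP ->; rewrite subr0.
  - move=> a x; rewrite !inE !(mcoeff1g_is_multiplicative _ _).1 => /eqP ->.
    by rewrite mulr0 mul0r.
have relJ r : qmat_relator r -> r \in J.
  by move=> /qmat_relator_augmentation r0; rewrite inE r0.
apply/negP => /asboolP /(_ J idJ relJ).
by rewrite inE mcoeff1 eqxx oner_eq0.
Qed.

Definition oneQ : OqM := lift_cst OqM 1.
Definition mulQ : OqM -> OqM -> OqM := lift_op2 OqM *%R.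
Definition scaleQ (c : k) : OqM -> OqM := lift_op1 OqM ( *:%R c).

Lemma qmat_piP (x y : freeMat) :
  reflect (\pi_OqM x = \pi_OqM y) (x - y \in qmat_ideal).
Proof. by rewrite Quotient.idealrBE; apply: eqP. Qed.

Lemma repr_qmat (x : freeMat) : repr (\pi_OqM x) - x \in qmat_ideal.
Proof. by apply/qmat_piP; rewrite reprK. Qed.

Lemma pi_oneQ : oneQ = \pi_OqM 1.
Proof. by unlock oneQ. Qed.

Lemma pi_mulQ (x y : freeMat) : mulQ (\pi_OqM x) (\pi_OqM y) = \pi_OqM (x * y).
Proof.
unlock mulQ; apply/qmat_piP; set x' := repr _; set y' := repr _.
have -> : x' * y' - x * y = (x' - x) * y' + x * (y' - y).
  by rewrite mulrBl mulrBr addrA subrK.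
apply: rpredD.
- exact: (qmat_idealM y' (repr_qmat x)).2.
- exact: (qmat_idealM x (repr_qmat y)).1.
Qed.

Lemma pi_scaleQ (c : k) (x : freeMat) : scaleQ c (\pi_OqM x) = \pi_OqM (c *: x).
Proof.
unlock scaleQ; apply/qmat_piP; rewrite -scalerBr -[repr _ - x]mul1r scalerAl.
exact: (qmat_idealM _ (repr_qmat x)).1.
Qed.

Lemma pi_addQ (x y : freeMat) : \pi_OqM x + \pi_OqM y = \pi_OqM (x + y).
Proof. by rewrite raddfD. Qed.

Lemma mulQA : associative mulQ.
Proof.
move=> x y z; rewrite -[x]reprK -[y]reprK -[z]reprK.
by rewrite !pi_mulQ mulrA.
Qed.

Lemma mul1Q : left_id oneQ mulQ.
Proof. by move=> x; rewrite -[x]reprK pi_oneQ pi_mulQ mul1r. Qed.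

Lemma mulQ1 : right_id oneQ mulQ.
Proof. by move=> x; rewrite -[x]reprK pi_oneQ pi_mulQ mulr1. Qed.

Lemma mulQDl : left_distributive mulQ +%R.
Proof.
move=> x y z; rewrite -[x]reprK -[y]reprK -[z]reprK.
by rewrite !(pi_mulQ, pi_addQ) mulrDl.
Qed.

Lemma mulQDr : right_distributive mulQ +%R.
Proof.
move=> x y z; rewrite -[x]reprK -[y]reprK -[z]reprK.
by rewrite !(pi_mulQ, pi_addQ) mulrDr.
Qed.

Lemma oneQ_neq0 : oneQ != 0.
Proof.
apply: contra qmat_ideal1 => /eqP one0.
by rewrite -[1]subr0; apply/qmat_piP; rewrite -pi_oneQ one0 raddf0.
Qed.

HB.instance Definition _ := GRing.Zmodule_isNzRing.Build OqM
  mulQA mul1Q mulQ1 mulQDl mulQDr oneQ_neq0.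

Lemma scaleQA (a b : k) (x : OqM) : scaleQ a (scaleQ b x) = scaleQ (a * b) x.
Proof. by rewrite -[x]reprK !pi_scaleQ scalerA. Qed.

Lemma scale1Q : left_id 1 scaleQ.
Proof. by move=> x; rewrite -[x]reprK pi_scaleQ scale1r. Qed.

Lemma scaleQDr : right_distributive scaleQ +%R.
Proof.
move=> c x y; rewrite -[x]reprK -[y]reprK.
by rewrite !(pi_scaleQ, pi_addQ) scalerDr.
Qed.

Lemma scaleQDl (x : OqM) : {morph scaleQ^~ x : a b / a + b}.
Proof.
by move=> a b; rewrite -[x]reprK !(pi_scaleQ, pi_addQ) scalerDl.
Qed.

HB.instance Definition _ := GRing.Zmodule_isLmodule.Build k OqM
  scaleQA scale1Q scaleQDr scaleQDl.

Lemma scaleQAl (c : k) (x y : OqM) : c *: (x * y) = (c *: x) * y.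
Proof.
rewrite -[x]reprK -[y]reprK; change (scaleQ c (mulQ (\pi_OqM (repr x))
  (\pi_OqM (repr y))) = mulQ (scaleQ c (\pi_OqM (repr x))) (\pi_OqM (repr y))).
by rewrite !(pi_scaleQ, pi_mulQ) scalerAl.
Qed.

HB.instance Definition _ := GRing.Lmodule_isLalgebra.Build k OqM scaleQAl.

Lemma scaleQAr (c : k) (x y : OqM) : c *: (x * y) = x * (c *: y).
Proof.
rewrite -[x]reprK -[y]reprK; change (scaleQ c (mulQ (\pi_OqM (repr x))
  (\pi_OqM (repr y))) = mulQ (\pi_OqM (repr x)) (scaleQ c (\pi_OqM (repr y)))).
by rewrite !(pi_scaleQ, pi_mulQ) freeMat_scaleAr.
Qed.

HB.instance Definition _ := GRing.Lalgebra_isAlgebra.Build k OqM scaleQAr.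

Definition Xq (i : 'I_n) (j : 'I_m) : OqM := \pi_OqM (Xfree i j).

End QuantumMatrices.

Section MaximalMinorPoset.

Variables (m n : nat).

Definition strictly_increasing (I : m.-tupleprod 'I_n) : bool :=
  [forall i : 'I_m, forall j : 'I_m, (i < j)%N ==> (tnth I i < tnth I j)%N].

(* An index i in {1, ..., n} is encoded by i - 1 : 'I_n; the order is the one
   induced by the product order on tuples. *)
Record PiMN := MkPiMN {
  PiMN_val : m.-tupleprod 'I_n;
  PiMN_incr : strictly_increasing PiMN_val }.

HB.instance Definition _ := [isSub for PiMN_val].
HB.instance Definition _ := [Finite of PiMN by <:].

Lemma strictly_increasingP (I : m.-tupleprod 'I_n) :
  reflect (forall i j : 'I_m, (i < j)%N -> (tnth I i < tnth I j)%N)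
          (I \in strictly_increasing).
Proof.
apply: (iffP forallP) => [incI i j|incI i]; last first.
  by apply/forallP => j; apply/implyP/incI.
by move/forallP: (incI i) => /(_ j) /implyP.
Qed.

Lemma strictly_increasing_meet : meet_closed strictly_increasing.
Proof.
move=> I J /strictly_increasingP incI /strictly_increasingP incJ.
apply/strictly_increasingP => i j ij; rewrite !tnth_meet.
change (tnth I i `&` tnth J i < tnth I j `&` tnth J j)%O.
have Iij : (tnth I i < tnth I j)%O := incI i j ij.
have Jij : (tnth J i < tnth J j)%O := incJ i j ij.
by rewrite ltxI !ltIx Iij Jij !orbT.
Qed.

Lemma strictly_increasing_join : join_closed strictly_increasing.
Proof.
move=> I J /strictly_increasingP incI /strictly_increasingP incJ.
apply/strictly_increasingP => i j ij; rewrite !tnth_join.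
change (tnth I i `|` tnth J i < tnth I j `|` tnth J j)%O.
have Iij : (tnth I i < tnth I j)%O := incI i j ij.
have Jij : (tnth J i < tnth J j)%O := incJ i j ij.
by rewrite ltUx !ltxU Iij Jij !orbT.
Qed.

HB.instance Definition _ :=
  Order.isLatticeClosed.Build _ _ strictly_increasing
    strictly_increasing_meet strictly_increasing_join.
HB.instance Definition _ := [SubChoice_isSubLattice of PiMN by <: with Order.Disp tt tt].

Lemma PiMN_meetUl :
  left_distributive (@Order.meet _ PiMN) (@Order.join _ PiMN).
Proof. by move=> I J K; apply: val_inj; apply: meetUl. Qed.

HB.instance Definition _ :=
  Order.Lattice_Meet_isDistrLattice.Build _ PiMN PiMN_meetUl.

End MaximalMinorPoset.

Section QuantumGrassmannian.

Variables (k : fieldType) (m n : nat) (q : k).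

(* The Coxeter length, as the number of inversions. *)
Definition perm_length (s : 'S_m) : nat :=
  #|[set p : 'I_m * 'I_m | (p.1 < p.2)%N && (s p.2 < s p.1)%N]|.

Definition qminor (I : PiMN m n) : OqM n m q :=
  \sum_(s : 'S_m) (- q) ^+ perm_length s *:
    \prod_(j < m) Xq q (tnth (PiMN_val I) j) (s j).

Definition OqG_pred : {pred OqM n m q} :=
  subalg_gen (fun x => exists I, x = qminor I).

HB.instance Definition _ := GRing.SubalgClosed.on OqG_pred.

Record OqG := MkOqG { OqG_val : OqM n m q; OqG_valP : OqG_val \in OqG_pred }.

HB.instance Definition _ := [isSub for OqG_val].
HB.instance Definition _ := [Choice of OqG by <:].
HB.instance Definition _ := [SubChoice_isSubAlgebra of OqG by <:].

Lemma qminor_OqG (I : PiMN m n) : qminor I \in OqG_pred.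
Proof. by apply/asboolP => B _; apply; exists I. Qed.

Definition OqG_minor (I : PiMN m n) : OqG := MkOqG (qminor_OqG I).

(* The span of the products of d minors.  As the minors generate the algebra,
   this is the only possible grading in which each of them has degree 1. *)
Definition OqG_degree (d : nat) (x : OqG) : Prop :=
  exists c : d.-tuple (PiMN m n) -> k,
    x = \sum_(t : d.-tuple (PiMN m n)) c t *: \prod_(I <- t) OqG_minor I.

End QuantumGrassmannian.

Section StraighteningLaw.

Variables (k : fieldType) (A : algType k).

Record is_grading (gr : nat -> A -> Prop) : Prop := {
  grading0 : forall e, gr e 0;
  gradingL : forall e (c : k) x y, gr e x -> gr e y -> gr e (c *: x + y);
  grading1 : gr 0 1;
  gradingM : forall e f x y, gr e x -> gr f y -> gr (e + f)%N (x * y);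
  grading_sum : forall x, exists (N : nat) (h : nat -> A),
    (forall e, gr e (h e)) /\ x = \sum_(e < N) h e;
  grading_direct : forall (N : nat) (h : nat -> A),
    (forall e, gr e (h e)) -> \sum_(e < N) h e = 0 ->
    forall e, (e < N)%N -> h e = 0 }.

Section Poset.

Variables (disp : Order.disp_t) (Pi : finPOrderType disp) (iota : Pi -> A).

Definition std_monomial (s : seq Pi) : A := \prod_(a <- s) iota a.

Definition std_independent : Prop :=
  forall (S : seq (seq Pi)) (c : seq Pi -> k),
    uniq S -> {in S, forall s, sorted <=%O s} ->
    \sum_(s <- S) c s *: std_monomial s = 0 -> {in S, forall s, c s = 0}.

Definition straddles (a b : Pi) (p : Pi * Pi) : bool :=
  [&& (p.1 < a)%O, (p.1 < b)%O, (a < p.2)%O & (b < p.2)%O].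

(* Coefficient families are total functions on Pi * Pi; only their values on
   the pairs straddling a and b are used. *)
Definition straddling_sum (a b : Pi) (c : Pi * Pi -> k) : A :=
  \sum_(p : Pi * Pi | straddles a b p) c p *: (iota p.1 * iota p.2).

Definition straightening_relation (a b : Pi) (c : Pi * Pi -> k) : Prop :=
  iota a * iota b = straddling_sum a b c.

Definition commutation_relation (a b : Pi) (qab : k) (d : Pi * Pi -> k) :
    Prop :=
  iota a * iota b - qab *: (iota b * iota a) = straddling_sum a b d.

Record symmetric_quantum_graded_ASL (gr : nat -> A -> Prop) : Prop := {
  asl_grading : is_grading gr;
  asl_homogeneous : forall a, exists2 e, (0 < e)%N & gr e (iota a);
  asl_generated : forall x, x \in subalg_gen (fun y => exists a, y = iota a);
  asl_independent : std_independent;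
  asl_straightening : forall a b, (a >< b)%O ->
    exists c, straightening_relation a b c;
  asl_commutation : forall a b,
    exists (qab : k) (d : Pi * Pi -> k),
      qab != 0 /\ commutation_relation a b qab d }.

End Poset.

Section ConditionC.

Variables (disp : Order.disp_t) (Pi : finDistrLatticeType disp).
Variable iota : Pi -> A.

Definition same_content (d : nat) (emb : Pi -> d.-tupleprod nat)
    (a b : Pi) (p : Pi * Pi) : bool :=
  perm_eq (emb a ++ emb b) (emb p.1 ++ emb p.2).

(* An injective lattice morphism into C_{N_1} x ... x C_{N_d}, where
   C_p = {1, ..., p}, viewed as a map into N^d. *)
Record increasing_chain_embedding (d : nat) (N : d.-tuple nat)
    (emb : Pi -> d.-tupleprod nat) : Prop := {
  emb_injective : injective emb;
  emb_meet : Order.meet_morphism emb;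
  emb_join : Order.join_morphism emb;
  emb_range : forall a i, (1 <= tnth (emb a) i <= tnth N i)%N;
  emb_increasing : forall a, sorted leq (emb a) }.

Definition condition_C : Prop :=
  exists (d : nat) (N : d.-tuple nat) (emb : Pi -> d.-tupleprod nat),
    [/\ (1 <= d)%N,
        forall i, (2 <= tnth N i)%N,
        increasing_chain_embedding N emb,
        forall a b, (a >< b)%O ->
          exists c, [/\ straightening_relation iota a b c,
            c (Order.meet a b, Order.join a b) != 0 &
            forall p, straddles a b p -> c p != 0 -> same_content emb a b p] &
        forall a b, exists (qab : k) (d : Pi * Pi -> k),
          [/\ qab != 0,
              commutation_relation iota a b qab d,
              straddles a b (Order.meet a b, Order.join a b) ->
                d (Order.meet a b, Order.join a b) = 0 &
              forall p, straddles a b p -> d p != 0 ->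
                same_content emb a b p]].

End ConditionC.

End StraighteningLaw.

(* Main.v *)
(* Two families of facts are needed: quadratic relations that let one rewrite any
   product [I][J] as a combination of standard products with the same content, and
   representations of the quantum matrix algebra in which standard monomials are
   independent.

   The first come from the Garnir relations: exchanging entries between [I] and [J]
   along a violation of I <= J decreases the sum of the entries of the first factor,
   so the process terminates, and each step preserves the content.

   For the second, a lattice of n x m commuting two by two quantum matrices gives a
   quantum matrix X whose entry X_ij is a sum over lattice paths; for a suitable
   weight the straight path dominates, so that [I] has the leading exponent of its
   diagonal term and distinct standard monomials have distinct leading exponents.
   Degenerating the cells outside a band lo_j <= i <= hi_j kills exactly the minors
   [I] that violate lo <= I <= hi and keeps the others independent.  Applying these
   representations to [I][J] = sum c [L][M] with lo = L, or with hi = M, forces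
   L <= I, J <= M; and as [I][J] has the same leading exponent as the product of the
   meet and the join, the coefficient of the latter is not zero.  The commutation
   relation of I and J is the difference of the two straightenings of [I][J] and
   [J][I], scaled so as to cancel these leading terms. *)
Require Import Defs.
From HB Require Import structures.
From mathcomp Require Import all_boot all_order all_algebra.
From mathcomp Require Import all_fingroup generic_quotient ring_quotient.
From mathcomp Require Import boolp functions zify ring.
From mathcomp.multinomials Require Import monalg.

Set Implicit Arguments.
Unset Strict Implicit.
Unset Printing Implicit Defensive.

Import Order.TTheory GRing.Theory Num.Theory.

Local Open Scope ring_scope.

(** * Linear operators on functions *)

Section Endomorphisms.

Variables (k : fieldType) (T : zmodType) (R : algType k).
Implicit Types u : T -> R.

Definition endo_pred : {pred (T -> R) -> (T -> R)} :=
  fun P => `[< linear P >].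

Record endo := MkEndo { endo_fun :> (T -> R) -> (T -> R);
                        endoP : endo_fun \in endo_pred }.

HB.instance Definition _ := [isSub for endo_fun].
HB.instance Definition _ := [Choice of endo by <:].

Lemma endo_submod_closed : submod_closed endo_pred.
Proof.
split=> [|a P Q /asboolP lP /asboolP lQ]; apply/asboolP => c u v.
  by change (0 = c *: 0 + 0 :> (T -> R)); rewrite scaler0 addr0.
change (a *: P (c *: u + v) + Q (c *: u + v) =
        c *: (a *: P u + Q u) + (a *: P v + Q v)).
rewrite lP lQ !scalerDr !scalerA [a * c]mulrC -!addrA; congr (_ + _).
by rewrite addrCA.
Qed.

HB.instance Definition _ :=
  GRing.isSubmodClosed.Build k _ endo_pred endo_submod_closed.
HB.instance Definition _ := [SubChoice_isSubLmodule of endo by <:].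

Lemma endo_ext (P Q : endo) : (forall u t, P u t = Q u t) -> P = Q.
Proof. by move=> PQ; apply/val_inj/funext => u; apply/funext => t; apply: PQ. Qed.

Lemma endoL (P : endo) : linear P.
Proof. exact: asboolW (endoP P). Qed.

Lemma endo_one_subproof : (fun u => u) \in endo_pred.
Proof. exact/asboolP. Qed.

Lemma endo_mul_subproof (P Q : endo) : (fun u => P (Q u)) \in endo_pred.
Proof. by apply/asboolP => a u v; rewrite !endoL. Qed.

Definition endo_one := MkEndo endo_one_subproof.
Definition endo_mul P Q := MkEndo (endo_mul_subproof P Q).

Lemma endoDE (P Q : endo) u t : (P + Q) u t = P u t + Q u t.
Proof. by []. Qed.
Lemma endoZE c (P : endo) u t : (c *: P) u t = c *: P u t.
Proof. by []. Qed.
Lemma endo0E u t : (0 : endo) u t = 0.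
Proof. by []. Qed.

Lemma endo_mulA : associative endo_mul.
Proof. by move=> P Q S; apply: endo_ext. Qed.
Lemma endo_mul1l : left_id endo_one endo_mul.
Proof. by move=> P; apply: endo_ext. Qed.
Lemma endo_mul1r : right_id endo_one endo_mul.
Proof. by move=> P; apply: endo_ext. Qed.
Lemma endo_mulDl : left_distributive endo_mul +%R.
Proof. by move=> P Q S; apply: endo_ext. Qed.
Lemma endo_mulDr : right_distributive endo_mul +%R.
Proof.
move=> P Q S; apply: endo_ext => u t /=.
by have := endoL P 1 (Q u) (S u); rewrite !scale1r => /(congr1 (@^~ t)).
Qed.
Lemma endo_one_neq0 : endo_one != 0.
Proof.
apply/eqP => /(congr1 (fun P : endo => P (fun=> 1) 0)) /eqP.
by rewrite endo0E oner_eq0.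
Qed.

HB.instance Definition _ := GRing.Zmodule_isNzRing.Build endo
  endo_mulA endo_mul1l endo_mul1r endo_mulDl endo_mulDr endo_one_neq0.

Lemma endo_scaleAl c (P Q : endo) : c *: (P * Q) = (c *: P) * Q.
Proof. exact: endo_ext. Qed.
HB.instance Definition _ := GRing.Lmodule_isLalgebra.Build k endo endo_scaleAl.

Lemma endo_scaleAr c (P Q : endo) : c *: (P * Q) = P * (c *: Q).
Proof.
apply: endo_ext => u t; rewrite endoZE /=.
have P0 : P 0 = 0.
  by have := endoL P (-1) 0 0; rewrite scaler0 addr0 scaleN1r addNr.
have := endoL P c (Q u) 0; rewrite P0 !addr0.
by move=> /(congr1 (fun v => v t)); exact: esym.
Qed.
HB.instance Definition _ := GRing.Lalgebra_isAlgebra.Build k endo endo_scaleAr.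

Lemma endoME (P Q : endo) u t : (P * Q) u t = P (Q u) t.
Proof. by []. Qed.
Lemma endo1E u t : (1 : endo) u t = u t.
Proof. by []. Qed.

Lemma wshift_subproof (chi : T -> R) (d : T) :
  (fun u t => chi t * u (t - d)) \in endo_pred.
Proof.
apply/asboolP => c u v; apply/funext => t.
by rewrite !fctE mulrDr scalerAr.
Qed.

(** A function on [T] is seen as a formal sum indexed by [T], possibly infinite: the index moves by
    [d] and the new index is weighted by [chi]. *)
Definition wshift chi d := MkEndo (wshift_subproof chi d).

Lemma wshiftE chi d u t : wshift chi d u t = chi t * u (t - d).
Proof. by []. Qed.

Lemma wshiftM chi chi' d d' :
  wshift chi d * wshift chi' d' = wshift (fun t => chi t * chi' (t - d)) (d + d').
Proof. by apply: endo_ext => u t; rewrite endoME !wshiftE mulrA opprD addrA. Qed.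

Lemma wshiftB chi chi' d :
  wshift chi d - wshift chi' d = wshift (fun t => chi t - chi' t) d.
Proof.
apply: endo_ext => u t; rewrite wshiftE mulrBl.
by change (wshift chi d u t - wshift chi' d u t = chi t * u (t - d) - chi' t * u (t - d)).
Qed.

Lemma wshiftZ c chi d : c *: wshift chi d = wshift (fun t => c *: chi t) d.
Proof. by apply: endo_ext => u t; rewrite endoZE !wshiftE scalerAl. Qed.

End Endomorphisms.

(** * R-matrix form of the relations *)

Section RTT.

Variables (k : fieldType) (q : k) (A : algType k).
Implicit Types X Y M N : nat -> nat -> A.

Definition eqw (i j : nat) : k := q ^+ (i == j).
Definition ltw (i j : nat) : k := (q - q^-1) *+ (i < j)%N.

(* All the relations of quantum matrices in a single identity (R X1 X2 = X2 X1 R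
   entrywise), which makes closure under matrix products uniform. *)
Definition rtt X := forall i h j l,
  eqw i h *: (X i j * X h l) + ltw h i *: (X h j * X i l) =
  eqw j l *: (X h l * X i j) + ltw j l *: (X h j * X i l).

(** The relation of [M] moves the R-matrix from the row indices to the summed indices; there,
    exchanging [a] and [b] turns it into the left side of the relation of [N]. *)
Lemma rtt_mul p M N : rtt M -> rtt N ->
  (forall i j h l, GRing.comm (M i j) (N h l)) ->
  rtt (fun i j => \sum_(a < p) M i a * N a j).
Proof.
move=> rM rN cMN i h j l.
have mulE i1 j1 h1 l1 : (\sum_(a < p) M i1 a * N a j1) *
    (\sum_(b < p) M h1 b * N b l1) =
  \sum_(a < p) \sum_(b < p) (M i1 a * M h1 b) * (N a j1 * N b l1).
  rewrite mulr_suml; apply: eq_bigr => a _; rewrite mulr_sumr.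
  apply: eq_bigr => b _.
  by rewrite !mulrA; congr (_ * _); rewrite -!mulrA; congr (_ * _); apply/esym/cMN.
rewrite !mulE !scaler_sumr -!big_split /=.
transitivity (\sum_(a < p) \sum_(b < p)
   (eqw a b *: (M h b * M i a) + ltw a b *: (M h a * M i b)) * (N a j * N b l)).
  apply: eq_bigr => a _; rewrite !scaler_sumr -big_split.
  by apply: eq_bigr => b _; rewrite -rM mulrDl -!scalerAl.
transitivity (\sum_(a < p) \sum_(b < p)
   (M h b * M i a) * (eqw a b *: (N a j * N b l) + ltw b a *: (N b j * N a l))).
  rewrite (eq_bigr (fun a : 'I_p =>
     \sum_(b < p) (M h b * M i a) * (eqw a b *: (N a j * N b l)) +
     \sum_(b < p) (M h a * M i b) * (ltw a b *: (N a j * N b l)))); last first.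
    move=> a _; rewrite -big_split; apply: eq_bigr => b _.
    by rewrite mulrDl -!scalerAl -!scalerAr.
  rewrite big_split /= [X in _ + X = _]exchange_big -big_split /=.
  by apply: eq_bigr => a _; rewrite -big_split; apply: eq_bigr => b _; rewrite mulrDr.
rewrite exchange_big; apply: eq_bigr => b _ /=; rewrite !scaler_sumr -big_split.
by apply: eq_bigr => a _; rewrite rN mulrDr -!scalerAr.
Qed.

Lemma rtt_reindex (f : nat -> nat) Y : {mono f : i j / (i < j)%N} ->
  rtt Y -> rtt (fun i j => Y i (f j)).
Proof.
move=> fM rY i h j l; rewrite rY /ltw fM.
suff -> : eqw (f j) (f l) = eqw j l by [].
by rewrite /eqw !eqn_leq leqNgt (leqNgt (f l)) !fM -!leqNgt.
Qed.

Definition mx2 (a b c d : A) (i j : nat) : A :=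
  match i, j with 0, 0 => a | 0, 1 => b | 1, 0 => c | 1, 1 => d | _, _ => 0 end.

Lemma rtt_mx2 a b c d : q != 0 ->
  a * b = q *: (b * a) -> c * d = q *: (d * c) ->
  a * c = q *: (c * a) -> b * d = q *: (d * b) -> b * c = c * b ->
  a * d - d * a = (q - q^-1) *: (b * c) -> rtt (mx2 a b c d).
Proof.
move=> q0 ab cd ac bd bc ad.
have {}ad : a * d = d * a + (q - q^-1) *: (b * c).
  by rewrite -ad addrC subrK.
(* The Hecke identity q^2 = 1 + (q - q^-1) q, needed for two entries in a common row or column. *)
have qq x : q *: (q *: x) = x + (q - q^-1) *: (q *: x) :> A.
  by rewrite !scalerA mulrBl mulVf // scalerBl scale1r addrC subrK.
by case=> [|[|i]]; case=> [|[|h]]; case=> [|[|j]]; case=> [|[|l]];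
  rewrite /eqw /ltw /=; rewrite ?mul0r ?mulr0 ?scaler0 ?addr0 //;
  rewrite ?mulr0n ?mulr1n ?scale0r ?addr0 ?expr0 ?expr1 ?scale1r //;
  rewrite ?ab ?cd ?ac ?bd ?qq ?bc // ad bc.
Qed.

Lemma comm_mx2 a b c d (x : A) :
  GRing.comm x a -> GRing.comm x b -> GRing.comm x c -> GRing.comm x d ->
  forall i j, GRing.comm x (mx2 a b c d i j).
Proof. by move=> ? ? ? ? [|[|i]] [|[|j]] //=; apply: commr0. Qed.

(* Right multiplication of Y by the identity matrix with the 2 x 2 block M
   inserted at the rows and columns c, c + 1. *)
Definition rstep (c : nat) M Y : nat -> nat -> A := fun j s =>
  if s == c then Y j c * M 0%N 0%N + Y j c.+1 * M 1%N 0%N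
  else if s == c.+1 then Y j c * M 0%N 1%N + Y j c.+1 * M 1%N 1%N
  else Y j s.

(** The cases are whether [j] and [l] lie in the block {c, c + 1}. Both inside: a matrix product
    restricted to the block. One inside: [M] factors out of a relation of [Y], because an outside
    index compares in the same way with [c] and [c + 1]. *)
Lemma rtt_step c M Y : rtt M -> rtt Y ->
  (forall i j h l, GRing.comm (Y i j) (M h l)) -> rtt (rstep c M Y).
Proof.
move=> rM rY cYM.
have blk j e : (e < 2)%N -> rstep c M Y j (c + e) =
    \sum_(a < 2) Y j (c + a)%N * M a e.
  rewrite /rstep !big_ord_recl big_ord0 /= addr0 addn0 addn1.
  by case: e => [|[|//]] _; rewrite ?addn0 ?eqxx // addn1 eqxx gtn_eqF.
have rB : rtt (fun j e => \sum_(a < 2) Y j (c + a)%N * M a e).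
  apply: (@rtt_mul 2 (fun j a => Y j (c + a)%N) M) => //.
  by apply: (@rtt_reindex (addn c)) => // i j; rewrite ltn_add2l.
have out j s : s != c -> s != c.+1 -> rstep c M Y j s = Y j s.
  by rewrite /rstep => /negPf -> /negPf ->.
have spl s : (exists2 e, (e < 2)%N & s = (c + e)%N) \/ (s != c /\ s != c.+1).
  case: (eqVneq s c) => [->|sc]; first by left; exists 0%N; rewrite ?addn0.
  case: (eqVneq s c.+1) => [->|sc1]; last by right.
  by left; exists 1%N; rewrite ?addn1.
have swp i j h l a b : Y i j * M a b * Y h l = Y i j * Y h l * M a b.
  by rewrite -!mulrA cYM.
move=> i h j l; case: (spl j) => [[e e2 ->]|[jc jc1]];
  case: (spl l) => [[f f2 ->]|[lc lc1]].
- rewrite !blk //; have := rB i h e f; rewrite /eqw /ltw.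
  by rewrite !eqn_add2l !ltn_add2l.
- rewrite !blk // !(out _ l) //.
  have eqwE a : (a < 2)%N -> eqw (c + a) l = eqw c l /\ ltw (c + a) l = ltw c l.
    rewrite /eqw /ltw => a2; split; congr (_ _ _); lia.
  have [-> ->] := eqwE e e2.
  rewrite !mulr_suml !mulr_sumr !scaler_sumr -!big_split /=.
  apply: eq_bigr => a _; have [eE lE] := eqwE a (ltn_ord a).
  rewrite !swp !mulrA; have /(congr1 (fun x => x * M a e)) := rY i h (c + a)%N l.
  by rewrite !mulrDl -!scalerAl eE lE.
- rewrite !blk // !(out _ j) //.
  have eqwE a : (a < 2)%N -> eqw j (c + a) = eqw j c /\ ltw j (c + a) = ltw j c.
    rewrite /eqw /ltw => a2; split; congr (_ _ _); lia.
  have [-> ->] := eqwE f f2.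
  rewrite !mulr_suml !mulr_sumr !scaler_sumr -!big_split /=.
  apply: eq_bigr => a _; have [eE lE] := eqwE a (ltn_ord a).
  rewrite !swp !mulrA; have /(congr1 (fun x => x * M a f)) := rY i h j (c + a)%N.
  by rewrite !mulrDl -!scalerAl eE lE.
- by rewrite !out // rY.
Qed.

Lemma rtt_id : rtt (fun i j => (i == j)%:R).
Proof.
move=> i h j l; rewrite -!natrM !mulnb [(h == l) && _]andbC; congr (_ + _).
  by case: eqP => [->|]; case: eqP => [->|]; rewrite ?scaler0.
by case: eqP => [->|]; case: eqP => [->|]; rewrite ?scaler0.
Qed.

End RTT.

(** * Representations on functions of exponents *)

Section Leading.

Variables (k : fieldType) (n m : nat).

Definition expo := (nat * nat)%type -> int.
HB.instance Definition _ := GRing.Zmodule.on expo.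

Notation op := (@endo k expo k^o).
Implicit Types (P Q : op) (u : expo -> k^o) (v : expo).

Definition dlt (i p : nat) : expo := fun c => (c == (i, p))%:R.

(* The weights (i + 1) p make a diagonal pair of positions strictly heavier than
   the corresponding antidiagonal pair. *)
Definition wgt (v : expo) : int :=
  \sum_(i < n) \sum_(p < m) (i.+1 * p)%:Z * v (i : nat, p : nat).

Lemma wgtD v v' : wgt (v + v') = wgt v + wgt v'.
Proof.
rewrite /wgt -big_split; apply: eq_bigr => i _; rewrite -big_split.
by apply: eq_bigr => p _; apply: mulrDr.
Qed.

Lemma wgt0 : wgt 0 = 0.
Proof. by rewrite /wgt big1 // => i _; rewrite big1 // => p _; rewrite mulr0. Qed.

Lemma wgtN v : wgt (- v) = - wgt v.
Proof. by apply/eqP; rewrite -subr_eq0 opprK -wgtD addNr wgt0. Qed.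

Lemma wgt_dlt i p : (i < n)%N -> (p < m)%N -> wgt (dlt i p) = (i.+1 * p)%:Z.
Proof.
move=> lin lpm; rewrite /wgt /dlt (bigD1 (Ordinal lin)) //= [X in _ + X]big1 ?addr0.
  rewrite (bigD1 (Ordinal lpm)) //= [X in _ + X]big1 ?addr0 ?eqxx ?mulr1 //.
  move=> p' /negPf pp'; rewrite xpair_eqE eqxx /=.
  by rewrite -val_eqE /= in pp'; rewrite pp' mulr0.
move=> i' /negPf ii'; rewrite -val_eqE /= in ii'; rewrite big1 // => p' _.
by rewrite xpair_eqE ii' mulr0.
Qed.

Definition supp_le u (N : int) := forall v, u v != 0 -> wgt v <= N.

Definition ordle P (N : int) :=
  forall u M, supp_le u M -> supp_le (P u) (N + M).

(** The weight does not separate exponents, hence the demand that the maximum be attained only at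
    [v]: leading exponents then add under composition. *)
Definition LT u v :=
  u v != 0 /\ forall v', u v' != 0 -> v' != v -> wgt v' < wgt v.

Definition lead P (d : expo) := forall u v, LT u v -> LT (P u) (d + v).

Lemma LT_supp u v : LT u v -> supp_le u (wgt v).
Proof.
move=> [_ uv] v' uv'; have [->//|vv'] := eqVneq v' v.
exact/ltW/uv.
Qed.

Lemma ordle0 N : ordle 0 N.
Proof. by move=> u M _ v; rewrite endo0E eqxx. Qed.

Lemma ordleW P N N' : N <= N' -> ordle P N -> ordle P N'.
Proof.
by move=> NN' PN u M uM v /(PN u M uM); move/le_trans; apply; rewrite lerD2r.
Qed.

Lemma ordleD P Q N : ordle P N -> ordle Q N -> ordle (P + Q) N.
Proof.
move=> PN QN u M uM v; rewrite endoDE => PQ.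
have [Pv|] := eqVneq (P u v) 0; last exact: PN.
by apply: (QN u M uM v); rewrite Pv add0r in PQ.
Qed.

Lemma ordleZ c P N : ordle P N -> ordle (c *: P) N.
Proof.
move=> PN u M uM v; rewrite endoZE => cP; apply: (PN u M uM).
by apply: contraNneq cP => ->; rewrite scaler0.
Qed.

Lemma ordle_sum (I : Type) (r : seq I) (F : I -> op) (p : pred I) N :
  (forall i, p i -> ordle (F i) N) -> ordle (\sum_(i <- r | p i) F i) N.
Proof. by move=> FN; elim/big_ind: _ => //; [exact: ordle0|move=> *; exact: ordleD]. Qed.

Lemma ordleM P Q N N' : ordle P N -> ordle Q N' -> ordle (P * Q) (N + N').
Proof. by move=> PN QN u M uM; rewrite -addrA; apply/PN/QN. Qed.

Lemma ordle1 : ordle 1 0.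
Proof. by move=> u M uM v; rewrite endo1E add0r; apply: uM. Qed.

Lemma ordle_wshift chi d : ordle (wshift chi d) (wgt d).
Proof.
move=> u M uM v; rewrite wshiftE => chv; rewrite -lerBlDl -wgtN -wgtD.
by apply: uM; apply: contraNneq chv => ->; rewrite mulr0.
Qed.

Lemma lead1 : lead 1 0.
Proof. by move=> u v; rewrite add0r. Qed.

Lemma lead_wshift chi d : (forall v, chi v != 0) -> lead (wshift chi d) d.
Proof.
move=> chi0 u v [uv ltv]; split=> [|v']; rewrite wshiftE.
  by rewrite addrAC subrr add0r mulf_neq0.
rewrite mulf_eq0 negb_or (chi0 v') /= => uv' v'd.
have := ltv _ uv'; rewrite !(wgtD, wgtN) ltrBlDl; apply.
by apply: contraNneq v'd => <-; rewrite addrC subrK.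
Qed.

Lemma leadM P Q d d' : lead P d -> lead Q d' -> lead (P * Q) (d + d').
Proof. by move=> Pd Qd u v uv; rewrite -addrA; apply/Pd/Qd. Qed.

Lemma leadZ c P d : c != 0 -> lead P d -> lead (c *: P) d.
Proof.
move=> c0 Pd u v uv; have [Pv ltPv] := Pd u v uv.
split=> [|v']; rewrite endoZE; first by rewrite mulf_neq0.
by move=> cP; apply: ltPv; apply: contraNneq cP => ->; rewrite scaler0.
Qed.

(** Weights are integers, so the bound [wgt d - 1] makes [Q] of strictly lower order and it cannot
    touch the leading coefficient. *)
Lemma leadD P Q d : lead P d -> ordle Q (wgt d - 1) -> lead (P + Q) d.
Proof.
move=> Pd Qd u v uv; have [Pv ltPv] := Pd u v uv.
have Qlt v' : Q u v' != 0 -> wgt v' < wgt (d + v).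
  by move/(Qd _ _ (LT_supp uv)); rewrite wgtD; lia.
have Q0 : Q u (d + v) = 0.
  by have [//|/Qlt] := eqVneq (Q u (d + v)) 0; rewrite ltxx.
split=> [|v']; rewrite endoDE ?Q0 ?addr0 // => PQ v'v.
have [Pv'|Pv'] := eqVneq (P u v') 0; last exact: ltPv.
by apply: Qlt; rewrite Pv' add0r in PQ.
Qed.

(* The transfer matrix built from q-oscillator cells *)
End Leading.

Section Transfer.

Variables (k : fieldType) (n m : nat) (q : k).
Hypothesis q0 : q != 0.
Variables lo hi : nat -> nat.

Notation op := (@endo k expo k^o).
Notation wshift := (@wshift k expo k^o).
Notation ordle := (@ordle k n m).
Notation lead := (@lead k n m).
Notation wgt := (wgt n m).

(* The cell (i, p) is crossed by the vertical strand of column p and the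
   horizontal strand of row i.  The entries a, b, c, d of its matrix describe the
   turns top -> left, top -> down, right -> left and right -> down.  Inside the
   band lo p <= i <= hi p it is a q-oscillator of zero quantum determinant; above
   the band strands only go down, below it they only go left. *)
Definition upz (i p : nat) := (i < lo p)%N.
Definition lowz (i p : nat) := (hi p < i)%N.

Definition qcre i p : op := wshift (fun=> 1) (dlt i p).
Definition qdiag i p : op := wshift (fun v : expo => q ^ (- v (i, p))) 0.
Definition qann i p : op := wshift (fun v : expo => q ^ (- 1 - 2 * v (i, p))) (- dlt i p).

Definition cella i p : op := if upz i p || lowz i p then 0 else qcre i p.
Definition cellb i p : op :=
  if upz i p then 1 else if lowz i p then 0 else qdiag i p.
Definition cellc i p : op :=
  if upz i p then 0 else if lowz i p then 1 else qdiag i p.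
Definition celld i p : op := if upz i p || lowz i p then 0 else qann i p.

Definition cell (c : nat * nat) : nat -> nat -> op :=
  mx2 (cella c.1 c.2) (cellb c.1 c.2) (cellc c.1 c.2) (celld c.1 c.2).

Lemma wshift_ext (chi chi' : expo -> k^o) d d' :
  chi =1 chi' -> d = d' -> wshift chi d = wshift chi' d' :> op.
Proof. by move=> /funext -> ->. Qed.

(** Outside the band every entry is 0 or 1; inside it the relations compare exponents of [q] after a
    shift. *)
Lemma rtt_cell c : rtt q (cell c).
Proof.
case: c => i p; rewrite /cell /cella /cellb /cellc /celld /=.
have [_|_] := ifP (upz i p); [|have [_|_] := ifP (lowz i p)];
  try by apply: rtt_mx2 => //; rewrite ?(mul0r, mulr0, mul1r, mulr1, scaler0, subr0).
have dl1 : dlt i p (i, p) = 1 by rewrite /dlt eqxx.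
have qs (a b : int) : a = b + 1 -> q ^ a = q * q ^ b.
  by move=> ->; rewrite expfzDr // mulrC expr1z.
have dE (v z : expo) : (v + z) (i, p) = v (i, p) + z (i, p) by [].
have nE (v : expo) : (- v) (i, p) = - v (i, p) by [].
have zE : (0 : expo) (i, p) = 0 by [].
have scE (a : k) (b : k^o) : a *: b = a * b :> k by [].
apply: rtt_mx2 => //; rewrite /qcre /qdiag /qann ?wshiftM ?wshiftZ; last first.
  rewrite subrr addNr addr0 wshiftB.
all: apply: wshift_ext => [v|]; rewrite ?addr0 ?add0r //.
all: rewrite !(dE, nE, zE, dl1, scE) ?oppr0 ?opprK ?addr0.
all: rewrite ?mul1r ?mulr1; set x := v (i, p).
(* With y = q^(-1 - 2 x), the products da, bc and ad are y, q y and q^2 y. *)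
- have -> : q ^ (-1 - 2 * (x - 1)) = q * (q * q ^ (-1 - 2 * x)).
    by rewrite -(qs (- 2 * x)); [apply: qs|]; lia.
  have -> : q ^ (- x) * q ^ (- x) = q * q ^ (-1 - 2 * x).
    by rewrite -expfzDr //; apply: qs; lia.
  by rewrite !mulrA mulrBl mulVf // mulrBl mul1r.
- rewrite mulrC [RHS]mulrCA; congr (_ * _); apply: qs; lia.
- apply: qs; lia.
- rewrite mulrC [RHS]mulrCA; congr (_ * _); apply: qs; lia.
- apply: qs; lia.
Qed.

Lemma comm_wshift (chi chi' : expo -> k^o) d d' :
  (forall v, chi' (v - d) = chi' v) -> (forall v, chi (v - d') = chi v) ->
  GRing.comm (wshift chi d) (wshift chi' d').
Proof.
move=> c'd cd'; rewrite /GRing.comm !wshiftM; apply: wshift_ext => [v|].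
  by rewrite c'd cd' mulrC.
exact: addrC.
Qed.

(** Distinct cells read and shift distinct coordinates of the exponent. *)
Lemma cell_local c a b c' a' b' : c != c' ->
  GRing.comm (cell c a b) (cell c' a' b').
Proof.
move=> cc'; case: c c' cc' => [i p] [i' p'] /negPf cc'.
have c'c : ((i', p') == (i, p)) = false by rewrite eq_sym.
have vE (v : expo) i1 p1 i2 p2 : ((i1, p1) == (i2, p2)) = false ->
    (v - dlt i2 p2) (i1, p1) = v (i1, p1).
  by move=> ne; change (v (i1, p1) - ((i1, p1) == (i2, p2))%:R = v (i1, p1));
    rewrite ne subr0.
have vE' (v : expo) i1 p1 i2 p2 : ((i1, p1) == (i2, p2)) = false ->
    (v - - dlt i2 p2) (i1, p1) = v (i1, p1).
  by move=> ne; change (v (i1, p1) - - ((i1, p1) == (i2, p2))%:R = v (i1, p1));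
    rewrite ne oppr0 subr0.
apply: comm_mx2; apply: commr_sym; apply: comm_mx2;
  rewrite /= /cella /cellb /cellc /celld /qcre /qdiag /qann;
  do !(case: ifP => _); do ?[exact: commr0|exact: commr1|
    by apply: commr_sym; apply: commr0|by apply: commr_sym; apply: commr1].
all: apply: comm_wshift => v; rewrite ?(vE _ _ _ _ _ cc', vE _ _ _ _ _ c'c,
  vE' _ _ _ _ _ cc', vE' _ _ _ _ _ c'c, subr0) //.
Qed.

(* Row i is crossed from its last column to its first one, so the cell (i, p) acts
   on the strands i + p and i + p + 1. *)
Fixpoint row_state (i t : nat) (Y : nat -> nat -> op) : nat -> nat -> op :=
  if t is t'.+1 then rstep (i + (m - t)) (cell (i, (m - t)%N)) (row_state i t' Y)
  else Y.

Fixpoint transfer (r : nat) : nat -> nat -> op :=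
  if r is r'.+1 then row_state r' m (transfer r') else fun i j => (i == j)%:R.

(* Y only involves cells that are not in C, so the next cell can be applied. *)
Definition fresh (Y : nat -> nat -> op) (C : nat * nat -> Prop) :=
  forall c, C c -> forall i j a b, GRing.comm (Y i j) (cell c a b).

Lemma fresh_step c s Y (C C' : nat * nat -> Prop) :
  (forall c', C' c' -> C c' /\ c' != c) -> fresh Y C -> fresh (rstep s (cell c) Y) C'.
Proof.
move=> CC' fY c' C'c i j a b; have [Cc c'c] := CC' c' C'c; apply: commr_sym.
have cY := fun i j => commr_sym (fY c' Cc i j a b).
have cM := fun a' b' => @cell_local c' a b c a' b' c'c.
by rewrite /rstep; do !case: ifP => _ //; apply: commrD; apply: commrM.
Qed.

Lemma row_stateP i t Y : (t <= m)%N -> rtt q Y ->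
  fresh Y (fun c => c.1 = i \/ (i < c.1)%N) ->
  rtt q (row_state i t Y) /\
  fresh (row_state i t Y) (fun c => c.1 = i /\ (c.2 < m - t)%N \/ (i < c.1)%N).
Proof.
move=> tm rY fY; elim: t tm => [|t IH] tm /=.
  by split=> // c [[ci _]|ci]; apply: fY; [left|right].
have [rS fS] := IH (ltnW tm); split.
  apply: rtt_step => //; first exact: rtt_cell.
  by apply: fS; left => /=; split => //; lia.
apply: fresh_step fS => -[a b] /= [[-> bm]|ia]; split.
- by left; split => //; lia.
- by rewrite xpair_eqE eqxx /=; lia.
- by right.
- by rewrite xpair_eqE; lia.
Qed.

Lemma transfer_rtt r : rtt q (transfer r) /\ fresh (transfer r) (fun c => (r <= c.1)%N).
Proof.
elim: r => [|r [rT fT]] /=.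
  split=> [|c _ i j a b]; first exact: rtt_id.
  by apply: commr_sym; apply: commr_nat.
have [|rS fS] := @row_stateP r m (transfer r) (leqnn m) rT.
  by move=> c rc; apply: fT; lia.
by split => // c rc; apply: fS; right.
Qed.

(* The operators carried, for the strand entering in column j, by the horizontal
   strand of row i after t cells and by the vertical strand p before row r. *)
Fixpoint hrz (V : nat -> op) (i t : nat) : op :=
  if t is t'.+1 then V (m - t)%N * cella i (m - t) + hrz V i t' * cellc i (m - t)
  else 0.

Fixpoint ver (j r : nat) : nat -> op :=
  if r is r'.+1 then fun p =>
    ver j r' p * cellb r' p + hrz (ver j r') r' (m - p.+1) * celld r' p
  else fun p => (j == p)%:R.

(** The horizontal strand of row [i] starts with 0 at position i + m and is at i + m - t after [t]
    cells; each vertical strand that it has crossed has moved one position up. *)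
Lemma row_stateE i j Y t V : (t <= m)%N ->
    (forall p, (p < m)%N -> Y j (i + p)%N = V p) -> Y j (i + m)%N = 0 ->
  [/\ forall s, (s < i + (m - t))%N -> row_state i t Y j s = Y j s,
      row_state i t Y j (i + (m - t))%N = hrz V i t,
      forall p, (m - t <= p < m)%N -> row_state i t Y j (i + p).+1 =
        V p * cellb i p + hrz V i (m - p.+1) * celld i p &
      forall s, (i + m < s)%N -> row_state i t Y j s = Y j s].
Proof.
move=> tm YV Y0; elim: t tm => [|t IH] tm.
  by rewrite subn0; split => //= p; lia.
have [IH1 IH2 IH3 IH4] := IH (ltnW tm).
have e1 : (i + (m - t.+1)).+1 = (i + (m - t))%N by lia.
split.
- move=> s sl /=; rewrite /rstep !ifN_eq; [|lia|lia]; apply: IH1; lia.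
- by rewrite /= /rstep eqxx e1 IH2 IH1 ?YV //; lia.
- move=> p /andP[mp pm] /=; rewrite /rstep ifN_eq; last lia.
  case: eqP => pE.
    have pt : p = (m - t.+1)%N by lia.
    rewrite e1 IH2 IH1 ?YV -?pt //; try lia.
    by have -> : (m - p.+1 = t)%N by lia.
  by apply: IH3; lia.
- by move=> s sl /=; rewrite /rstep !ifN_eq ?IH4 //; lia.
Qed.

(** After [r] rows the vertical strand [p] is at position r + p, and the first [r] positions hold
    the outputs of the completed rows. *)
Lemma transferE r j : (j < m)%N ->
  [/\ forall p, (p < m)%N -> transfer r j (r + p)%N = ver j r p,
      forall s, (r + m <= s)%N -> transfer r j s = 0 &
      forall i, (i < r)%N -> transfer r j i = hrz (ver j i) i m].
Proof.
move=> jm; elim: r => [|r [IHv IH0 IHh]] /=.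
  split=> // s; rewrite add0n => ms; have -> // : (j == s) = false by lia.
have [H1 H2 H3 H4] := row_stateE (leqnn m) IHv (IH0 _ (leqnn _)).
split.
- by move=> p pm; rewrite addSn H3 //; lia.
- by move=> s sl; rewrite H4 ?IH0 //; lia.
- move=> i; rewrite ltnS leq_eqVlt => /orP[/eqP->|ir].
    by have := H2; rewrite subnn addn0.
  by rewrite H1 ?IHh //; lia.
Qed.

End Transfer.

(** * Orders and leading exponents of the matrix entries *)

Section Entries.

Variables (k : fieldType) (n m : nat) (q : k).
Hypothesis q0 : q != 0.
Variables lo hi : nat -> nat.
Hypothesis lo_mono : {homo lo : i j / (i <= j)%N}.
Hypothesis hi_mono : {homo hi : i j / (i <= j)%N}.

Notation op := (@endo k expo k^o).
Notation ordle := (@ordle k n m).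
Notation lead := (@lead k n m).
Notation cella := (@cella k lo hi).
Notation cellb := (cellb q lo hi).
Notation cellc := (cellc q lo hi).
Notation celld := (celld q lo hi).
Notation hrz := (hrz m q lo hi).
Notation ver := (ver m q lo hi).

Lemma ordle_cella i p : (i < n)%N -> (p < m)%N -> ordle (cella i p) (i.+1 * p)%:Z.
Proof.
move=> lin lpm; rewrite /cella; case: ifP => _; first exact: ordle0.
by rewrite -(@wgt_dlt n m) //; apply: ordle_wshift.
Qed.

Lemma ordle_celld i p : (i < n)%N -> (p < m)%N -> ordle (celld i p) (- (i.+1 * p)%:Z).
Proof.
move=> lin lpm; rewrite /celld; case: ifP => _; first exact: ordle0.
by rewrite -(@wgt_dlt n m) // -wgtN; apply: ordle_wshift.
Qed.

Lemma ordle_qdiag i p : ordle (qdiag q i p) 0.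
Proof. by rewrite -(wgt0 n m); apply: ordle_wshift. Qed.

Lemma ordle_cellb i p : ordle (cellb i p) 0.
Proof.
rewrite /cellb; case: ifP => _; first exact: ordle1.
by case: ifP => _; [exact: ordle0|exact: ordle_qdiag].
Qed.

Lemma ordle_cellc i p : ordle (cellc i p) 0.
Proof.
rewrite /cellc; case: ifP => _; first exact: ordle0.
by case: ifP => _; [exact: ordle1|exact: ordle_qdiag].
Qed.

Lemma lead_qdiag i p : lead (qdiag q i p) 0.
Proof. by apply: lead_wshift => v; apply: expfz_neq0. Qed.

Lemma hrz_gt V i j t : (forall p, (j < p < m)%N -> V p = 0) ->
  (t <= m)%N -> (j < m - t)%N -> hrz V i t = 0.
Proof.
move=> V0; elim: t => //= t IH tm jt; rewrite IH ?V0 ?mul0r ?addr0 //; lia.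
Qed.

(** Paths only go down or to the left. *)
Lemma ver_gt j r p : (j < p < m)%N -> ver j r p = 0.
Proof.
elim: r p => [|r IH] p jp /=; first by have -> : (j == p) = false by lia.
by rewrite IH // (@hrz_gt _ _ j) ?mul0r ?addr0 //; try exact: IH; lia.
Qed.

(** A path that turns left in column p <= j has order at most i (j - p) + (i + 1) p <= (i + 1) j. *)
Lemma hrz_ord V i j t :
  (forall p, (p <= j)%N -> (p < m)%N -> ordle (V p) (i * (j - p))%:Z) ->
  (forall p, (j < p < m)%N -> V p = 0) ->
  (i < n)%N -> (t <= m)%N -> ordle (hrz V i t) (i.+1 * j)%:Z.
Proof.
move=> Vo V0 lin; elim: t => [|t IH] tm /=; first exact: ordle0.
have lm : (m - t.+1 < m)%N by lia.
apply: ordleD; last first.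
  by rewrite -[_%:Z]addr0; apply: ordleM; [exact/IH/ltnW|exact: ordle_cellc].
case: (leqP (m - t.+1) j) => pj; last first.
  by rewrite V0 ?mul0r ?pj //; exact: ordle0.
apply: ordleW (ordleM (Vo _ pj lm) (ordle_cella lin lm)).
by rewrite -PoszD lez_nat; nia.
Qed.

(* A path that leaves column j and is in column p above row r gains weight at most
   r (j - p); the only path attaining (i + 1) j on row i goes straight down and then
   straight left. *)
Lemma ver_ord j r p : (r <= n)%N -> (p <= j)%N -> (p < m)%N ->
  ordle (ver j r p) (r * (j - p))%:Z.
Proof.
elim: r p => [|r IH] p rn pj pm /=.
  by rewrite mul0n; case: eqP => _; [exact: ordle1|exact: ordle0].
have rn' := ltnW rn; apply: ordleD.
  have := ordleM (IH p rn' pj pm) (@ordle_cellb r p).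
  by apply: ordleW; rewrite addr0 lez_nat; nia.
have V o := IH o rn'.
have tm : (m - p.+1 <= m)%N by lia.
have := ordleM (@hrz_ord _ r j (m - p.+1) V (@ver_gt j r) rn tm) (ordle_celld rn pm).
apply: ordleW.
have -> : (r.+1 * j = r.+1 * (j - p) + r.+1 * p)%N by nia.
by rewrite PoszD addrK.
Qed.

Lemma ver_lead j r : (j < m)%N ->
  (forall i, (i < r)%N -> ~~ lowz hi i j) -> lead (ver j r j) 0.
Proof.
move=> jm; elim: r => [|r IH] nlow /=; first by rewrite eqxx; exact: lead1.
rewrite (@hrz_gt _ _ j) ?mul0r ?addr0; try exact: ver_gt; try lia.
rewrite -(addr0 0); apply: leadM; first by apply: IH => i ir; apply/nlow/ltnW.
rewrite /cellb (negPf (nlow r (leqnn _))).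
by case: ifP => _; [exact: lead1|exact: lead_qdiag].
Qed.

(** The path straight down column [j] and then left contributes [dlt i j]. Entering row [i] in a
    column p < j makes a path lighter by at least j - p. Monotonicity of [lo] keeps the cells to the
    left of column [j] from being above the band, so the horizontal strand passes through them. *)
Lemma hrz_lead j i : (i < n)%N -> (j < m)%N -> (lo j <= i <= hi j)%N ->
  lead (hrz (ver j i) i m) (dlt i j).
Proof.
move=> lin ljm /andP[loi ihi].
suff H t : (t <= m)%N -> (m - j <= t)%N -> lead (hrz (ver j i) i t) (dlt i j).
  by apply: H => //; lia.
elim: t => [|t IH] tm jt; first lia.
have [jtE|jt'] := eqVneq (m - j)%N t.+1; rewrite /=.
  have -> : (m - t.+1 = j)%N by lia.
  rewrite (@hrz_gt _ _ j) ?mul0r ?addr0; try exact: ver_gt; try lia.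
  rewrite -[dlt i j]add0r; apply: leadM.
    by apply: ver_lead => // r ri; rewrite /lowz; lia.
  rewrite /cella /upz /lowz ifN ?negb_or -?leqNgt ?loi ?ihi //.
  by apply: lead_wshift => v; apply: oner_neq0.
set p := (m - t.+1)%N; have pj : (p < j)%N by rewrite /p; lia.
have pm : (p < m)%N by lia.
rewrite addrC; apply: leadD.
  rewrite -[dlt i j]addr0; apply: leadM; first by apply: IH; lia.
  rewrite /cellc /upz ifN; last by have := lo_mono (ltnW pj); lia.
  by case: ifP => _; [exact: lead1|exact: lead_qdiag].
apply: ordleW (ordleM (ver_ord (ltnW lin) (ltnW pj) pm) (ordle_cella lin pm)).
rewrite wgt_dlt //.
have -> : (i.+1 * j = i * (j - p) + i.+1 * p + (j - p))%N by nia.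
by rewrite !PoszD lerBrDr lerD2l lez_nat subn_gt0.
Qed.

(** Above the band the strand of column [j] can only go down, so nothing reaches row [i]. *)
Lemma hrz_upz j i : (i < lo j)%N -> (j < m)%N -> hrz (ver j i) i m = 0.
Proof.
move=> ilo jm.
have H0 r t : (r < lo j)%N -> (forall p, (p < m)%N -> p != j -> ver j r p = 0) ->
    (t <= m)%N -> hrz (ver j r) r t = 0.
  move=> rlo V0; elim: t => //= t IH tm; rewrite IH ?mul0r ?addr0 //; last lia.
  have [->|pj] := eqVneq (m - t.+1)%N j.
    by rewrite /cella /upz rlo mulr0.
  by rewrite V0 ?mul0r //; lia.
apply: (H0) => //; elim: i ilo => [|i IH] ilo p pm pj /=.
  by rewrite eq_sym (negPf pj).
have {}IH := IH (ltnW ilo).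
by rewrite IH // H0 ?mul0r ?addr0 //; [exact: ltnW|lia].
Qed.

(** For p <= j one has hi p <= hi j < i, so all these cells of row [i] are below the band and none
    lets a strand turn from top to left. *)
Lemma hrz_lowz j i : (hi j < i)%N -> (j < m)%N -> hrz (ver j i) i m = 0.
Proof.
move=> hii jm; suff H t : (t <= m)%N -> hrz (ver j i) i t = 0 by exact: H.
elim: t => //= t IH tm; rewrite IH ?mul0r ?addr0 //; last lia.
have [pj|jp] := leqP (m - t.+1) j; last by rewrite ver_gt ?mul0r //; lia.
rewrite /cella [lowz _ _ _](_ : _ = true) ?orbT ?mulr0 //.
by rewrite /lowz; have := hi_mono pj; lia.
Qed.

(** [transfer] takes the entrance column first and the exit row second, hence the transposition. *)
Definition repX (i : 'I_n) (j : 'I_m) : op := transfer m q lo hi n j i.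

Lemma repXE (i : 'I_n) (j : 'I_m) : repX i j = hrz (ver j i) i m.
Proof. by rewrite /repX; have [_ _ ->] := transferE q0 lo hi n (ltn_ord j). Qed.

Lemma repX_rtt (i h : 'I_n) (j l : 'I_m) :
  eqw q j l *: (repX i j * repX h l) + ltw q l j *: (repX i l * repX h j) =
  eqw q i h *: (repX h l * repX i j) + ltw q i h *: (repX i l * repX h j).
Proof. exact: (transfer_rtt m q0 lo hi n).1. Qed.

Lemma repX_ord i j : ordle (repX i j) (i.+1 * j)%:Z.
Proof.
rewrite repXE; apply: hrz_ord => // [p pj pm|p]; last exact: ver_gt.
by apply: ver_ord => //; exact/ltnW.
Qed.

Lemma repX_lead (i : 'I_n) (j : 'I_m) :
  (lo j <= i <= hi j)%N -> lead (repX i j) (dlt i j).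
Proof. by rewrite repXE; apply: hrz_lead. Qed.

Lemma repX0 (i : 'I_n) (j : 'I_m) : ~~ (lo j <= i <= hi j)%N -> repX i j = 0.
Proof.
rewrite repXE negb_and -!ltnNge => /orP[?|?]; [exact: hrz_upz|exact: hrz_lowz].
Qed.

End Entries.

(** * Quantum matrices over an arbitrary algebra *)

Record qmatrix (k : fieldType) (q : k) n m (B : algType k)
    (X : 'I_n -> 'I_m -> B) : Prop := QMatrix {
  qm_row : forall (i : 'I_n) (j l : 'I_m), (j < l)%N ->
    X i j * X i l = q *: (X i l * X i j);
  qm_col : forall (i h : 'I_n) (j : 'I_m), (i < h)%N ->
    X i j * X h j = q *: (X h j * X i j);
  qm_anti : forall (i h : 'I_n) (j l : 'I_m), (i < h)%N -> (j < l)%N ->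
    X i l * X h j = X h j * X i l;
  qm_diag : forall (i h : 'I_n) (j l : 'I_m), (i < h)%N -> (j < l)%N ->
    X i j * X h l = X h l * X i j + (q - q^-1) *: (X i l * X h j) }.

Lemma qmatrix_tr (k : fieldType) (q : k) n m (B : algType k)
    (X : 'I_n -> 'I_m -> B) : qmatrix q X -> qmatrix q (fun j i => X i j).
Proof.
move=> [r c a d]; split=> [i j l jl|i h j ih|i h j l ih jl|i h j l ih jl].
- exact: c.
- exact: r.
- exact/esym/a.
- by rewrite d // (a j l i h).
Qed.

Lemma rtt_qmatrix (k : fieldType) (q : k) n m (B : algType k)
    (X : 'I_n -> 'I_m -> B) : q != 0 ->
  (forall (i h : 'I_n) (j l : 'I_m),
     eqw q i h *: (X i j * X h l) + ltw q h i *: (X h j * X i l) =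
     eqw q j l *: (X h l * X i j) + ltw q j l *: (X h j * X i l)) ->
  qmatrix q X.
Proof.
move=> q0 rX; have qqM x : q *: x - (q - q^-1) *: x = q^-1 *: x :> B.
  by rewrite -scalerBl opprB addrCA subrr addr0.
(* For two entries of one row the R-matrix relation has an extra multiple of [x] on the right;
   absorbing it leaves q^-1 x = y. *)
have qV (x y : B) : q *: x = y + (q - q^-1) *: x -> x = q *: y.
  by move/(canLR (addrK _)); rewrite qqM => <-; rewrite scalerA divff ?scale1r.
have anti (i h : 'I_n) (j l : 'I_m) : (i < h)%N -> (j < l)%N ->
    X i l * X h j = X h j * X i l.
  move=> ih jl; have := rX i h l j; rewrite /eqw /ltw.
  have -> : (i == h :> nat) = false by lia.
  have -> : (l == j :> nat) = false by lia.
  have -> : (h < i)%N = false by lia.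
  have -> : (l < j)%N = false by lia.
  by rewrite !mulr0n !scale0r !expr0 !scale1r !addr0.
split=> [i j l jl|i h j ih|//|i h j l ih jl].
- have := rX i i j l; rewrite /eqw /ltw eqxx ltnn jl.
  have -> : (j == l :> nat) = false by lia.
  by rewrite mulr1n expr1 expr0 mulr0n scale0r scale1r addr0 => /qV.
- have := rX i h j j; rewrite /eqw /ltw eqxx ltnn.
  have -> : (i == h :> nat) = false by lia.
  have -> : (h < i)%N = false by lia.
  by rewrite !mulr0n expr1 expr0 !scale0r scale1r !addr0.
- have := rX i h j l; rewrite /eqw /ltw jl.
  have -> : (i == h :> nat) = false by lia.
  have -> : (j == l :> nat) = false by lia.
  have -> : (h < i)%N = false by lia.
  by rewrite !mulr0n !mulr1n !expr0 !scale0r !scale1r !addr0 -(anti i h j l).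
Qed.

(** * The universal property of the quantum matrix algebra *)

Section Universal.

Variables (k : fieldType) (n m : nat) (q : k).
Local Open Scope quotient_scope.
Notation freeMat := {malg k[{fmonom ('I_n * 'I_m)%type}]}.

Lemma Xq_qmatrix : qmatrix q (@Xq k n m q).
Proof.
have pq (x y : freeMat) : qmat_relator q (x - y) ->
    \pi_(OqM n m q) x = \pi_(OqM n m q) y.
  by move=> xy; apply/qmat_piP/asboolP => J _; apply.
have mE (i h : 'I_n) (j l : 'I_m) : Xq q i j * Xq q h l =
    \pi_(OqM n m q) (Xfree k i j * Xfree k h l) by rewrite -pi_mulQ.
have zE c x : c *: \pi_(OqM n m q) x = \pi_(OqM n m q) (c *: x).
  by rewrite -pi_scaleQ.
split=> [i j l jl|i h j ih|i h j l ih jl|i h j l ih jl]; rewrite !mE ?zE.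
- by apply: pq; apply: QMrow.
- by apply: pq; apply: QMcol.
- by apply: pq; apply: QManti.
- by rewrite pi_addQ; apply: pq; rewrite opprD addrA; apply: QMdiag.
Qed.

Section Lift.

Variables (B : algType k) (X : 'I_n -> 'I_m -> B).
Hypothesis qX : qmatrix q X.

Definition monom_eval (w : {fmonom ('I_n * 'I_m)%type}) : B :=
  \prod_(c <- (w : seq _)) X c.1 c.2.

Lemma monom_eval_mmorphism : mmorphism monom_eval.
Proof.
split=> [x y|]; rewrite /monom_eval; first by rewrite fmM big_cat.
by rewrite fm1 big_nil.
Qed.

HB.instance Definition _ :=
  monalg.isMultiplicative.Build _ _ monom_eval monom_eval_mmorphism.

Definition free_eval : freeMat -> B := mmap (in_alg B) monom_eval.

Lemma free_evalM x y : free_eval (x * y) = free_eval x * free_eval y.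
Proof.
apply: (commr_mmap_is_multiplicative (f := in_alg B) (h := monom_eval) _).1.
by move=> g w w'; rewrite /GRing.comm -scalerAl -scalerAr mul1r mulr1.
Qed.

Lemma free_eval1 : free_eval 1 = 1.
Proof. exact: mmap1. Qed.

Lemma free_evalB x y : free_eval (x - y) = free_eval x - free_eval y.
Proof. exact: mmapB. Qed.

Lemma free_evalZ c x : free_eval (c *: x) = c *: free_eval x.
Proof. by rewrite /free_eval mmapZ -scalerAl mul1r. Qed.

Lemma free_evalX i j : free_eval (Xfree k i j) = X i j.
Proof.
by rewrite /free_eval /Xfree mmapU /= scale1r mul1r /= /monom_eval fmU big_seq1.
Qed.

(** The kernel of the evaluation is a two-sided ideal that contains the relators. *)
Lemma free_eval_ideal x : x \in qmat_ideal q -> free_eval x = 0.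
Proof.
have evM i j h l : free_eval (Xfree k i j * Xfree k h l) = X i j * X h l.
  by rewrite free_evalM !free_evalX.
have evMZ c i j h l :
    free_eval (c *: (Xfree k i j * Xfree k h l)) = c *: (X i j * X h l).
  by rewrite free_evalZ evM.
pose J : {pred freeMat} := fun x => free_eval x == 0.
have JE y : (y \in J) = (free_eval y == 0) by [].
have evB a b a' b' :
    free_eval a = a' -> free_eval b = b' -> free_eval (a - b) = a' - b'.
  by move=> <- <-; apply: free_evalB.
have idJ : two_sided_ideal J.
  refine (conj (conj _ _) _).
  - by rewrite JE -(subr0 0) free_evalB subrr.
  - by move=> y z; rewrite !JE => /eqP y0 /eqP z0; rewrite (evB _ _ _ _ y0 z0) subr0.
  - move=> y z; rewrite JE => /eqP z0; split; rewrite JE; apply/eqP.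
      by rewrite (free_evalM y z) z0 mulr0.
    by rewrite (free_evalM z y) z0 mul0r.
have relJ r : qmat_relator q r -> free_eval r = 0.
  case=> [i j l jl|i h j ih|i h j l ih jl|i h j l ih jl].
  - apply: etrans (evB _ _ _ _ (evM _ _ _ _) (evMZ _ _ _ _ _)) _.
    by rewrite (qm_row qX) ?subrr.
  - apply: etrans (evB _ _ _ _ (evM _ _ _ _) (evMZ _ _ _ _ _)) _.
    by rewrite (qm_col qX) ?subrr.
  - apply: etrans (evB _ _ _ _ (evM _ _ _ _) (evM _ _ _ _)) _.
    by rewrite (qm_anti qX) ?subrr.
  - apply: etrans (evB _ _ _ _ (evB _ _ _ _ (evM _ _ _ _) (evM _ _ _ _))
                               (evMZ _ _ _ _ _)) _.
    by apply/eqP; rewrite -addrA -opprD subr_eq0 (qm_diag qX).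
move=> /asboolP /(_ J idJ) xJ; apply/eqP; rewrite -JE; apply: xJ => r /relJ r0.
by rewrite JE r0.
Qed.

(** The proof that [X] is a quantum matrix is a parameter, so that the map itself can carry the
    linear and multiplicative structures declared below. *)
Definition OqM_lift (_ : qmatrix q X) (x : OqM n m q) : B := free_eval (repr x).

Lemma OqM_lift_pi x : (OqM_lift qX) (\pi x) = free_eval x.
Proof.
by apply/eqP; rewrite -subr_eq0 -free_evalB; apply/eqP/free_eval_ideal/repr_qmat.
Qed.

Lemma OqM_lift_linear : linear (OqM_lift qX).
Proof.
move=> c x y; have -> : c *: x + y = \pi_(OqM n m q) (c *: repr x + repr y).
  by rewrite -pi_addQ -pi_scaleQ !reprK.
rewrite OqM_lift_pi; apply: etrans (mmapD _ _) _.
by rewrite -/free_eval free_evalZ.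
Qed.

Lemma OqM_lift_monoid : GRing.monoid_morphism (OqM_lift qX).
Proof.
split; first by rewrite -[1]/(oneQ n m q) pi_oneQ OqM_lift_pi; exact: free_eval1.
move=> x y; have -> : x * y = \pi_(OqM n m q) (repr x * repr y).
  by rewrite -pi_mulQ !reprK.
by rewrite OqM_lift_pi free_evalM.
Qed.

HB.instance Definition _ :=
  GRing.isLinear.Build k (OqM n m q) B *:%R (OqM_lift qX) OqM_lift_linear.
HB.instance Definition _ :=
  GRing.isMonoidMorphism.Build (OqM n m q) B (OqM_lift qX) OqM_lift_monoid.

Lemma OqM_liftX i j : (OqM_lift qX) (Xq q i j) = X i j.
Proof. by rewrite OqM_lift_pi free_evalX. Qed.

End Lift.

End Universal.

(** * Quantum minors and Garnir relations *)

Section SetCombinatorics.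

Variable n : nat.
Implicit Types (T U V : {set 'I_n}) (j : 'I_n).

Definition num_below T j : nat := \sum_(x in T) (x < j)%N.
(** The number of inversions created by listing [U] before [V]: the exponent of -q in a Laplace
    expansion. *)
Definition set_inv U V : nat := \sum_(j in U) num_below V j.

Lemma num_belowU1 T j l : j \notin T ->
  num_below (j |: T) l = ((j < l) + num_below T l)%N.
Proof. by move=> jT; rewrite /num_below big_setU1. Qed.

Lemma num_belowD1 T j l : j \in T -> num_below T l = ((j < l) + num_below (T :\ j) l)%N.
Proof. by move=> jT; rewrite /num_below (big_setD1 j). Qed.

Lemma num_below_split T U l : U \subset T ->
  num_below T l = (num_below U l + num_below (T :\: U) l)%N.
Proof. by move=> UT; rewrite /num_below (big_setID U) (setIidPr UT). Qed.

Lemma set_invU1 U V j : j \notin U ->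
  set_inv (j |: U) V = (num_below V j + set_inv U V)%N.
Proof. by move=> jU; rewrite /set_inv big_setU1. Qed.

Lemma enum_set_sorted T : sorted (fun i j : 'I_n => (i < j)%N) (enum T).
Proof.
rewrite /enum_mem; apply: sorted_filter; first by move=> ? ? ?; apply: ltn_trans.
by rewrite -enumT -(sorted_map (f := val) (e' := ltn)) val_enum_ord iota_ltn_sorted.
Qed.

Lemma sorted_ltn_eq (s t : seq 'I_n) :
  sorted (fun i j : 'I_n => (i < j)%N) s ->
  sorted (fun i j : 'I_n => (i < j)%N) t -> s =i t -> s = t.
Proof.
apply: irr_sorted_eq => [y x z|x]; [exact: ltn_trans|exact: ltnn].
Qed.

Lemma enum_cons T j : j \in T -> (forall i, i \in T -> (j <= i)%N) ->
  enum T = j :: enum (T :\ j).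
Proof.
move=> jT jmin; apply: sorted_ltn_eq; first exact: enum_set_sorted.
  rewrite /= path_min_sorted; first exact: enum_set_sorted.
  apply/allP => i; rewrite mem_enum !inE => /andP[ij iT].
  by rewrite ltn_neqAle jmin // eq_sym andbT.
by move=> i; rewrite inE !mem_enum !inE; case: eqVneq => [->|].
Qed.

Lemma setD1C T i j : T :\ i :\ j = T :\ j :\ i.
Proof. by apply/setP => x; rewrite !inE andbCA. Qed.

Lemma set_min T : T != set0 ->
  exists2 j, j \in T & forall i, i \in T -> (j <= i)%N.
Proof.
by move=> /set0Pn[x xT]; case: (arg_minnP (fun i : 'I_n => i : nat) xT) => j; exists j.
Qed.

End SetCombinatorics.

Section Minors.

Variables (k : fieldType) (q : k) (B : algType k).

(* The minor with rows s and columns T, by Laplace expansion along the first row;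
   s is any word in the rows, and the minor vanishes unless #|T| = size s. *)
Fixpoint minr n m (X : 'I_n -> 'I_m -> B) (s : seq 'I_n) (T : {set 'I_m}) : B :=
  if s is i :: s' then
    \sum_(j in T) (- q) ^+ num_below T j *: (X i j * minr X s' (T :\ j))
  else (T == set0)%:R.

Section Fixed.

Variables (n m : nat) (X : 'I_n -> 'I_m -> B).
Implicit Types (s : seq 'I_n) (T U : {set 'I_m}).
Notation minr := (minr X).

Lemma minr_size s T : size s != #|T| -> minr s T = 0.
Proof.
elim: s T => [|i s IH] T /=.
  by rewrite eq_sym cards_eq0 => /negPf ->.
move=> sT; rewrite big1 // => j jT; rewrite IH ?mulr0 ?scaler0 //.
by move: sT; rewrite (cardsD1 j) jT eqSS.
Qed.

(** Laplace expansion along the rows [s]. In the induction the first column [j] joins the set of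
    columns chosen later, and the elements of [T] below [j] are divided between [U] and its
    complement. *)
Lemma minr_cat s s' T : minr (s ++ s') T =
  \sum_(U : {set 'I_m} | U \subset T)
     (- q) ^+ set_inv U (T :\: U) *: (minr s U * minr s' (T :\: U)).
Proof.
elim: s T => [|i s IH] T /=.
  rewrite (bigD1 set0) ?sub0set //= big1 => [|U /andP[_ /negPf->]]; last first.
    by rewrite mul0r scaler0.
  by rewrite eqxx mul1r setD0 /set_inv big_set0 expr0 scale1r addr0.
transitivity (\sum_(j in T) \sum_(U : {set 'I_m} | U \subset T :\ j)
  (- q) ^+ (num_below T j + set_inv U (T :\ j :\: U)) *:
    (X i j * minr s U * minr s' (T :\ j :\: U))).
  apply: eq_bigr => j jT; rewrite IH mulr_sumr scaler_sumr.
  by apply: eq_bigr => U _; rewrite -scalerAr scalerA -exprD mulrA.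
transitivity (\sum_(j in T) \sum_(U : {set 'I_m} | (U \subset T) && (j \in U))
  (- q) ^+ (set_inv U (T :\: U) + num_below U j) *:
    (X i j * minr s (U :\ j) * minr s' (T :\: U))); last first.
  rewrite (exchange_big_dep (fun U : {set 'I_m} => U \subset T)) /=; last first.
    by move=> j U _ /andP[].
  apply: eq_bigr => U UT; rewrite mulr_suml scaler_sumr.
  apply: eq_big => [j|j /andP[_ /andP[_ jU]]].
    by rewrite UT andb_idl // => /(subsetP UT).
  by rewrite -scalerAl scalerA exprD.
apply: eq_bigr => j jT; symmetry.
rewrite (reindex_onto (fun U : {set 'I_m} => j |: U) (fun U => U :\ j)) /=; last first.
  by move=> U /andP[_ jU]; rewrite setD1K.
have memU (U : {set 'I_m}) :
    (j |: U \subset T) && (j \in j |: U) && ((j |: U) :\ j == U) =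
    (U \subset T :\ j).
  rewrite subUset sub1set jT setU11 andbT /= subsetD1; apply: andb_id2l => UT.
  apply/eqP/idP => [<-|jU]; last exact: setU1K.
  by rewrite !inE eqxx.
apply: eq_big => [//|U]; rewrite memU => UT.
have jU : j \notin U by apply/negP => /(subsetP UT); rewrite !inE eqxx.
have -> : T :\: (j |: U) = T :\ j :\: U by rewrite setDDl.
rewrite setU1K // set_invU1 // num_belowU1 // ltnn (num_belowD1 _ jT) ltnn !add0n.
by rewrite (num_below_split _ UT); congr (_ ^+ _ *: _); lia.
Qed.

(** Exchanging the columns chosen for the first two rows costs a factor -q; grouping the two choices
    produces brackets to which the quadratic relations apply. *)
Lemma minr_two h i s T : minr (h :: i :: s) T =
  \sum_(j in T) \sum_(l in T | (j < l)%N)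
    (- q) ^+ (num_below T j + num_below (T :\ j) l) *:
    ((X h j * X i l - q *: (X h l * X i j)) * minr s (T :\ j :\ l)).
Proof.
pose G (j l : 'I_m) := (- q) ^+ (num_below T j + num_below (T :\ j) l) *:
    (X h j * X i l * minr s (T :\ j :\ l)).
transitivity (\sum_(j in T) \sum_(l in T | l != j) G j l).
  apply: eq_bigr => j jT /=; rewrite mulr_sumr scaler_sumr.
  apply: eq_big => [l|l _]; first by rewrite !inE andbC.
  by rewrite -scalerAr scalerA -exprD mulrA.
transitivity (\sum_(j in T) \sum_(l in T | (j < l)%N) (G j l + G l j)).
  transitivity (\sum_(j in T) (\sum_(l in T | (j < l)%N) G j l
                               + \sum_(l in T | (l < j)%N) G j l)).
    apply: eq_bigr => j jT; rewrite (bigID (fun l : 'I_m => (j < l)%N)) /=.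
    congr (_ + _); apply: eq_bigl => l; rewrite -val_eqE /=; lia.
  rewrite big_split /= [X in _ + X = _](exchange_big_dep (mem T)) /=; last first.
    by move=> j l _ /andP[].
  rewrite -big_split /=; apply: eq_bigr => j jT; rewrite big_split /=.
  by congr (_ + _); apply: eq_bigl => l; rewrite jT.
apply: eq_bigr => j jT; apply: eq_bigr => l /andP[lT jl].
have jl' : j != l by rewrite -val_eqE /=; lia.
have -> : G l j = (- q) ^+ (num_below T j + num_below (T :\ j) l) *:
    ((- q *: (X h l * X i j)) * minr s (T :\ j :\ l)).
  rewrite /G -scalerAl scalerA -exprSr; congr (_ ^+ _ *: (_ * minr s _)).
    rewrite (num_belowD1 l jT) (num_belowD1 j lT) jl [(l < j)%N]ltnNge (ltnW jl).
    by rewrite add0n add1n addSn addnC.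
  by apply/setP => x; rewrite !inE andbCA.
by rewrite /G -scalerDr -mulrDl scaleNr.
Qed.

Hypothesis qX : qmatrix q X.
Hypothesis q0 : q != 0.

Lemma minr_dup i s T : minr (i :: i :: s) T = 0.
Proof.
rewrite minr_two big1 // => j _; rewrite big1 // => l /andP[_ jl].
by rewrite (qm_row qX) // subrr mul0r scaler0.
Qed.

Lemma minr_swap (i h : 'I_n) s T : (i < h)%N ->
  minr (h :: i :: s) T = - q *: minr (i :: h :: s) T.
Proof.
move=> ih; rewrite !minr_two scaler_sumr; apply: eq_bigr => j _.
rewrite scaler_sumr; apply: eq_bigr => l /andP[_ jl].
rewrite scalerA [- q * _]mulrC -scalerA; congr (_ *: _).
rewrite [RHS]scalerAl; congr (_ * _).
rewrite (qm_diag qX ih jl) -(qm_anti qX ih jl) !scalerBr !scalerDr !scalerA.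
rewrite -[RHS]addrA -scalerBl [RHS]addrC scaleNr; congr (_ - _).
have -> : - q * (q - q^-1) - - q * q = 1 by field.
by rewrite scale1r.
Qed.

Lemma minr_cons_eq i s s' c : (forall T, minr s T = c *: minr s' T) ->
  forall T, minr (i :: s) T = c *: minr (i :: s') T.
Proof.
move=> ss' T; rewrite /= scaler_sumr; apply: eq_bigr => j _.
by rewrite ss' -scalerAr !scalerA mulrC.
Qed.

Lemma minr_swapE (i h : 'I_n) s :
  exists2 c, c != 0 & forall T, minr (h :: i :: s) T = c *: minr (i :: h :: s) T.
Proof.
case: (ltngtP i h) => [ih|hi|/val_inj ->].
- by exists (- q); [rewrite oppr_eq0|move=> T; apply: minr_swap].
- exists (- q)^-1 => [|T]; first by rewrite invr_eq0 oppr_eq0.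
  by rewrite (minr_swap _ _ hi) scalerA mulVf ?scale1r // oppr_eq0.
- by exists 1 => [|T]; rewrite ?oner_eq0 ?scale1r.
Qed.

(** A rearrangement is a product of adjacent transpositions, each of which costs a nonzero
    scalar. *)
Lemma minr_perm s s' : perm_eq s s' ->
  exists2 c, c != 0 & forall T, minr s T = c *: minr s' T.
Proof.
have front i s1 s2 : exists2 c, c != 0 &
    forall T, minr (s1 ++ i :: s2) T = c *: minr (i :: s1 ++ s2) T.
  elim: s1 => [|h s1 [c c0 IH]].
    by exists 1 => [|T]; rewrite ?oner_eq0 ?scale1r.
  have [d d0 sw] := minr_swapE i h (s1 ++ s2).
  exists (c * d) => [|T]; first by rewrite mulf_neq0.
  by rewrite cat_cons (minr_cons_eq _ IH) sw scalerA.
elim: s' s => [|i s' IH] s.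
  by move=> /perm_nilP ->; exists 1 => [|T]; rewrite ?oner_eq0 ?scale1r.
move=> ss'; have /splitPr sP : i \in s by rewrite (perm_mem ss') mem_head.
case: sP ss' => s1 s2 ss'.
have [c c0 E] := front i s1 s2.
have /IH[d d0 E'] : perm_eq (s1 ++ s2) s'.
  by rewrite -(perm_cons i) -[i :: s1 ++ s2]/([:: i] ++ s1 ++ s2) -(perm_catCA s1).
exists (c * d) => [|T]; first by rewrite mulf_neq0.
by rewrite E (minr_cons_eq _ E') scalerA.
Qed.

Lemma minr_nuniq s T : ~~ uniq s -> minr s T = 0.
Proof.
elim: s T => [//|i s IH] T; have [si _|si] := boolP (i \in s); last first.
  rewrite /= si /= => ns; rewrite big1 // => j _.
  by rewrite IH // mulr0 scaler0.
have /minr_perm[c _ E] : perm_eq (i :: s) (i :: i :: rem i s).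
  by rewrite perm_cons perm_to_rem.
by rewrite E minr_dup scaler0.
Qed.

End Fixed.

(* Expanding along the first row and then the first column, or the other way
   round, gives the same terms because antidiagonal entries commute. *)
Lemma minr_tr n m (X : 'I_n -> 'I_m -> B) (S : {set 'I_n}) (T : {set 'I_m}) :
  qmatrix q X ->
  minr X (enum S) T = minr (fun j i => X i j) (enum T) S.
Proof.
move=> qX; have [N] := ubnP #|S|; elim: N S T => // N IH S T.
rewrite ltnS => SN.
have enum0 d : enum (set0 : {set 'I_d}) = [::].
  by apply/eqP; rewrite -size_eq0 -cardE cards0.
have [->|S0] := eqVneq S set0.
  rewrite enum0 /=; have [->|T0] := eqVneq T set0.
    by rewrite enum0 /= eqxx.
  by rewrite minr_size // -cardE cards0 cards_eq0.
have [->|T0] := eqVneq T set0.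
  rewrite enum0 /= (negPf S0); rewrite minr_size // -cardE cards0 cards_eq0 //.
have [i0 i0S i0min] := set_min S0; have [j0 j0T j0min] := set_min T0.
rewrite (enum_cons i0S i0min) (enum_cons j0T j0min) /=.
have num_below0 d (U : {set 'I_d}) (x : 'I_d) : (forall y, y \in U -> (x <= y)%N) ->
    num_below U x = 0%N.
  by move=> xm; rewrite /num_below big1 // => y /xm; rewrite leqNgt => /negPf ->.
have ltN i : i \in S -> (#|S :\ i| < N)%N.
  by move=> iS; move: SN; rewrite (cardsD1 i) iS.
rewrite (big_setD1 j0) //= (big_setD1 i0) //= !num_below0 //; congr (_ + _).
  by rewrite IH // ltN.
have minD d (U : {set 'I_d}) x y : (forall z, z \in U -> (x <= z)%N) -> 
    forall z, z \in U :\ y -> (x <= z)%N.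
  by move=> xm z; rewrite !inE => /andP[_ /xm].
transitivity (\sum_(j in T :\ j0) \sum_(i in S :\ i0)
  (- q) ^+ ((num_below (T :\ j0) j).+1 + num_below (S :\ i0) i) *:
  (X i0 j * X i j0 * minr X (enum (S :\ i0 :\ i)) (T :\ j0 :\ j))).
  apply: eq_bigr => j jT'; have [jj0 jT] : j != j0 /\ j \in T by apply/setD1P.
  have j0j : (j0 < j)%N by rewrite ltn_neqAle j0min // andbT eq_sym.
  have j0T' : j0 \in T :\ j by rewrite !inE j0T andbT eq_sym.
  rewrite IH ?ltN // (enum_cons j0T' (minD _ _ _ _ j0min)) /=.
  rewrite mulr_sumr scaler_sumr; apply: eq_bigr => i iS'.
  rewrite -scalerAr scalerA -exprD (num_belowD1 j j0T) j0j mulrA.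
  have iS : i \in S by move: iS'; rewrite !inE => /andP[].
  rewrite IH; last first.
    apply: leq_ltn_trans (ltN _ iS).
    by apply: subset_leq_card; apply: setSD; apply: subD1set.
  by rewrite (setD1C T).
rewrite exchange_big; apply: eq_bigr => i iS' /=.
have [ii0 iS] : i != i0 /\ i \in S by apply/setD1P.
have i0i : (i0 < i)%N by rewrite ltn_neqAle i0min // andbT eq_sym.
have i0S' : i0 \in S :\ i by rewrite !inE i0S andbT eq_sym.
rewrite -IH ?ltN // (enum_cons i0S' (minD _ _ _ _ i0min)) /=.
rewrite mulr_sumr scaler_sumr; apply: eq_bigr => j jT'.
have [jj0 jT] : j != j0 /\ j \in T by apply/setD1P.
have j0j : (j0 < j)%N by rewrite ltn_neqAle j0min // andbT eq_sym.
rewrite -scalerAr scalerA -exprD (num_belowD1 i i0S) i0i mulrA (qm_anti qX) //.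
rewrite addSn add1n addSn [(num_below (T :\ j0) j + _)%N]addnC.
by rewrite (setD1C S).
Qed.

(* After Laplace expansion the sum over K' is a column-wise minor of a word in more
   than m columns, which has a repetition. *)
Lemma garnir n m (X : 'I_n -> 'I_m -> B) (J1 J2 : seq 'I_n) (K : {set 'I_n}) :
  q != 0 -> qmatrix q X -> (m < #|K|)%N ->
  \sum_(K' : {set 'I_n} | K' \subset K) (- q) ^+ set_inv K' (K :\: K') *:
    (minr X (J1 ++ enum K') setT * minr X (enum (K :\: K') ++ J2) setT) = 0.
Proof.
move=> q0 qX mK; pose Y j i := X i j.
have qY : qmatrix q Y by apply: qmatrix_tr.
(* Laplace expansion splits off [J1] and [J2]; for fixed [U] and [V] the sum over [K'] is the
   expansion of one transposed minor on all of [K]. *)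
transitivity (\sum_(U : {set 'I_m} | U \subset setT)
  \sum_(V : {set 'I_m} | V \subset setT)
  ((- q) ^+ set_inv U (setT :\: U) * (- q) ^+ set_inv V (setT :\: V)) *:
   (minr X J1 U * minr Y (enum (setT :\: U) ++ enum V) K * minr X J2 (setT :\: V))).
  rewrite [RHS](eq_bigr (fun U : {set 'I_m} =>
    \sum_(K' : {set 'I_n} | K' \subset K) \sum_(V : {set 'I_m} | V \subset setT)
    (- q) ^+ set_inv K' (K :\: K') *: (
    ((- q) ^+ set_inv U (setT :\: U) *: (minr X J1 U * minr X (enum K') (setT :\: U))) *
    ((- q) ^+ set_inv V (setT :\: V) *:
      (minr X (enum (K :\: K')) V * minr X J2 (setT :\: V)))))); last first.
    move=> U _; rewrite exchange_big; apply: eq_bigr => V _ /=.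
    rewrite minr_cat mulr_sumr mulr_suml scaler_sumr; apply: eq_bigr => K' K'K.
    rewrite -!scalerAr -!scalerAl !scalerA !(minr_tr _ _ qX) !mulrA.
    by congr (_ *: _); rewrite mulrC mulrA mulrAC.
  rewrite exchange_big; apply: eq_bigr => K' K'K /=.
  rewrite !minr_cat mulr_suml scaler_sumr; apply: eq_bigr => U _.
  by rewrite mulr_sumr scaler_sumr.
rewrite big1 // => U _; rewrite big1 // => V _.
have [sz|sz] := eqVneq (size (enum (setT :\: U) ++ enum V)) #|K|; last first.
  by rewrite (minr_size _ sz) mulr0 mul0r scaler0.
rewrite (minr_nuniq qY q0) ?mulr0 ?mul0r ?scaler0 //.
apply/negP => /card_uniqP un.
have := max_card (mem (enum (setT :\: U) ++ enum V)).
by rewrite un card_ord sz leqNgt mK.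
Qed.

End Minors.

(** * Expansion of minors over permutations *)

Section Leibniz.

Variables (k : fieldType) (q : k) (B : algType k) (n m : nat).
Variable X : 'I_n -> 'I_m -> B.

Fixpoint seq_inv (c : seq 'I_m) : nat :=
  if c is j :: c' then count (fun x : 'I_m => (x < j)%N) c' + seq_inv c' else 0.

Lemma permutations_cons (T : {set 'I_m}) : T != set0 ->
  perm_eq (permutations (enum T))
    [seq j :: c | j <- enum T, c <- permutations (enum (T :\ j))].
Proof.
move=> T0; apply: uniq_perm => [||c]; first exact: permutations_uniq.
  apply: allpairs_uniq_dep => [|j _|[j c] [j' c'] _ _ [-> ->]] //; first exact: enum_uniq.
  exact: permutations_uniq.
have rE j : j \in T -> perm_eq (enum T) (j :: enum (T :\ j)).
  move=> jT; apply: uniq_perm => [||x]; first exact: enum_uniq.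
    by rewrite /= mem_enum !inE eqxx enum_uniq.
  by rewrite inE !mem_enum !inE; case: eqVneq => [->|].
rewrite mem_permutations; apply/idP/allpairsPdep.
  case: c => [/perm_size/=|j c pc].
    by rewrite -cardE => /esym/eqP; rewrite cards_eq0 (negPf T0).
  have jT : j \in T by rewrite -mem_enum -(perm_mem pc) mem_head.
  exists j, c; split => //; first by rewrite mem_enum.
  by rewrite mem_permutations -(perm_cons j) (permPl pc) rE.
move=> [j [c' [jT c'P ->]]]; rewrite mem_enum in jT.
by rewrite (permPr (rE _ jT)) perm_cons -mem_permutations.
Qed.

Lemma minr_permutations s (T : {set 'I_m}) : size s = #|T| ->
  minr q X s T = \sum_(c <- permutations (enum T))
    (- q) ^+ seq_inv c *: \prod_(p <- zip s c) X p.1 p.2.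
Proof.
elim: s T => [|i s IH] T /= sT.
  have -> : T = set0 by apply: cards0_eq.
  have -> : enum (set0 : {set 'I_m}) = [::].
    by apply/eqP; rewrite -size_eq0 -cardE cards0.
  by rewrite eqxx big_seq1 big_nil scale1r.
have T0 : T != set0 by rewrite -cards_eq0 -sT.
rewrite (perm_big _ (permutations_cons T0)) big_allpairs_dep /= big_enum.
apply: eq_bigr => j jT; rewrite IH; last first.
  by move: sT; rewrite (cardsD1 j) jT => -[].
rewrite mulr_sumr scaler_sumr big_seq [RHS]big_seq; apply: eq_bigr => c.
rewrite mem_permutations => pc; rewrite big_cons -scalerAr scalerA -exprD /=.
congr ((- q) ^+ (_ + _) *: _); rewrite -sum1_count (perm_big _ pc) /=.
rewrite (num_belowD1 j jT) ltnn add0n /num_below [RHS]big_mkcond /= big_enum /=.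
by apply: eq_bigr => x _; case: (x < j)%N.
Qed.

Lemma seq_inv_map (f : 'I_m -> 'I_m) (s : seq 'I_m) :
  sorted (fun i j : 'I_m => (i < j)%N) s ->
  seq_inv (map f s) = (\sum_(i <- s) \sum_(j <- s | i < j) (f j < f i))%N.
Proof.
elim: s => [|i s IH] /=; first by rewrite big_nil.
move=> pis; have /IH E := path_sorted pis.
have /allP ltis : all (fun j : 'I_m => (i < j)%N) s.
  by apply: order_path_min pis => ? ? ?; apply: ltn_trans.
rewrite big_cons big_cons ltnn E count_map -sum1_count; congr (_ + _)%N.
  rewrite big_mkcond big_seq [RHS]big_seq_cond; apply: eq_big => [j|j js] /=.
    by rewrite andb_idr // => /ltis.
  by case: (_ < _)%N.
rewrite big_seq [RHS]big_seq; apply: eq_bigr => j js.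
by rewrite big_cons ltnNge (ltnW (ltis _ js)).
Qed.

Lemma perm_eq_permutations :
  perm_eq (permutations (enum [set: 'I_m]))
    [seq [seq s j | j <- enum 'I_m] | s : 'S_m <- enum {: 'S_m}].
Proof.
apply: uniq_perm; first exact: permutations_uniq.
  rewrite map_inj_uniq ?enum_uniq // => s t /eq_in_map st.
  by apply/permP => j; apply: st; rewrite mem_enum.
move=> c; rewrite mem_permutations; apply/idP/mapP => [pc|[s _ ->]].
  have sc : size c = m by rewrite (perm_size pc) -cardE cardsT card_ord.
  have uc : uniq c by rewrite (perm_uniq pc) enum_uniq.
  (* The default [j] is never returned, as [size c = m]; it avoids choosing an element of a possibly
     empty type. *)
  have fI : injective (fun j : 'I_m => nth j c j).
    move=> i j /eqP; rewrite (set_nth_default j) ?sc // nth_uniq ?sc //.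
    by move/eqP/val_inj.
  exists (perm fI); first by rewrite mem_enum.
  have [cn|[x0 _ _]] : c = [::] \/ exists2 x0 : 'I_m, x0 \in c & True.
  - by case: (c) => [|x r]; [left|right; exists x; rewrite ?mem_head].
  - rewrite [LHS]cn; apply/esym/size0nil.
    by rewrite size_map -cardE card_ord -[LHS]sc cn.
  - apply: (@eq_from_nth _ x0) => [|i].
      by rewrite size_map -cardE card_ord.
    rewrite sc => im; rewrite (nth_map x0) ?size_enum_ord // permE.
    have -> : nth x0 (enum 'I_m) i = Ordinal im.
      by apply: val_inj; rewrite /= nth_enum_ord.
    by apply: set_nth_default; rewrite sc.
apply: uniq_perm; first by rewrite map_inj_uniq ?enum_uniq //; exact: perm_inj.
  exact: enum_uniq.
move=> j; rewrite mem_enum inE; apply/mapP; exists ((s^-1)%g j).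
  by rewrite mem_enum.
by rewrite permKV.
Qed.

(** This identifies the recursive minor with the sum over permutations that defines [qminor]. *)
Lemma minr_leibniz (I : m.-tuple 'I_n) :
  minr q X I setT = \sum_(s : 'S_m) (- q) ^+ perm_length s *:
    \prod_(j < m) X (tnth I j) (s j).
Proof.
rewrite minr_permutations ?size_tuple ?cardsT ?card_ord //.
rewrite (perm_big _ perm_eq_permutations) big_map big_enum.
apply: eq_bigr => s _; congr ((- q) ^+ _ *: _).
  rewrite seq_inv_map; last first.
    rewrite -(sorted_map (f := val) (e' := ltn)) val_enum_ord.
    exact: iota_ltn_sorted.
  rewrite /perm_length -sum1_card big_enum /=.
  rewrite (eq_bigr (fun i : 'I_m => \sum_(j < m | i < j) (s j < s i))%N); last first.
    by move=> i _; rewrite big_enum_cond; apply: eq_bigl => j; rewrite inE.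
  rewrite pair_big_dep big_mkcond [RHS]big_mkcond; apply: eq_bigr => -[i j] _ /=.
  by rewrite inE /=; case: (i < j)%N => //=; case: ifP.
have -> : zip I [seq s j | j <- enum 'I_m] = [seq (tnth I j, s j) | j <- enum 'I_m].
  rewrite -{1}[I : seq _]map_tnth_enum.
  by elim: (enum 'I_m) => //= j r ->.
by rewrite big_map [index_enum _]unlock enumT.
Qed.

End Leibniz.

(** * Straightening *)

Section PiTheory.

Variables m n : nat.
Implicit Types I J K : PiMN m n.

Definition pent I (j : 'I_m) : 'I_n := tnth (PiMN_val I) j.
Definition pseq I : seq 'I_n := PiMN_val I.

Lemma pseqE I : pseq I = [seq pent I j | j <- enum 'I_m].
Proof. by rewrite /pseq -[in LHS](map_tnth_enum (PiMN_val I)). Qed.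

Lemma size_pseq I : size (pseq I) = m.
Proof. by rewrite pseqE size_map -cardE card_ord. Qed.

Lemma nth_pseq x0 I (j : 'I_m) : nth x0 (pseq I) j = pent I j.
Proof. by rewrite /pent (tnth_nth x0). Qed.

Lemma pent_lt I (i j : 'I_m) : (i < j)%N -> (pent I i < pent I j)%N.
Proof. exact: (strictly_increasingP _ (PiMN_incr I)). Qed.

Lemma pent_mono I (i j : 'I_m) : (pent I i < pent I j)%N = (i < j)%N.
Proof.
case: (ltngtP i j) => [/pent_lt->//|/(pent_lt I) ji|/val_inj->].
  by rewrite ltnNge ltnW.
by rewrite ltnn.
Qed.

Lemma pseq_sorted I : sorted (fun i j : 'I_n => (i < j)%N) (pseq I).
Proof.
rewrite pseqE sorted_map.
apply: (sub_sorted (e := fun i j : 'I_m => (i < j)%N)) => [i j|]; first exact: pent_lt.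
rewrite -(sorted_map (f := val) (e' := ltn)) val_enum_ord.
exact: iota_ltn_sorted.
Qed.

Lemma PiMN_of_seq (s : seq 'I_n) : uniq s -> size s = m ->
  exists I, perm_eq (pseq I) s.
Proof.
move=> us sm; pose T := [set x in s].
have Tm : size (enum T) == m by rewrite -cardE cardsE (card_uniqP us) sm.
have inc : strictly_increasing (Tuple Tm : m.-tupleprod 'I_n).
  apply/strictly_increasingP => i j ij.
  have x0 : 'I_n := tnth (Tuple Tm) i.
  rewrite !(tnth_nth x0) /=.
  apply: (sorted_ltn_nth _ _ (enum_set_sorted T)) => //; rewrite ?inE ?(eqP Tm) //.
  by move=> ? ? ?; apply: ltn_trans.
exists (MkPiMN inc); apply: uniq_perm => //; first exact: enum_uniq.
by move=> x; rewrite mem_enum inE.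
Qed.

Lemma PiMN_leP I J : reflect (forall j, (pent I j <= pent J j)%N) (I <= J)%O.
Proof.
have -> : (I <= J)%O = (PiMN_val I <= PiMN_val J)%O by [].
by rewrite leEtprod; apply: forallP.
Qed.

Lemma pent_meet I J j : (pent (Order.meet I J) j : nat) = minn (pent I j) (pent J j).
Proof.
rewrite /pent -[PiMN_val (Order.meet I J)]/(Order.meet (PiMN_val I) (PiMN_val J)).
by rewrite tnth_meet; case: leP; rewrite ?leEord ?ltEord /=; lia.
Qed.

Lemma pent_join I J j : (pent (Order.join I J) j : nat) = maxn (pent I j) (pent J j).
Proof.
rewrite /pent -[PiMN_val (Order.join I J)]/(Order.join (PiMN_val I) (PiMN_val J)).
by rewrite tnth_join; case: leP; rewrite ?leEord ?ltEord /=; lia.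
Qed.

Lemma pent_inj I J : (forall j, pent I j = pent J j) -> I = J.
Proof. by move=> IJ; apply/val_inj/eq_from_tnth. Qed.

Lemma pseq_perm_inj I J : perm_eq (pseq I) (pseq J) -> I = J.
Proof.
move=> /perm_mem IJ; apply/val_inj/val_inj.
exact: sorted_ltn_eq (pseq_sorted I) (pseq_sorted J) IJ.
Qed.

End PiTheory.

(** [A :\: B] and [B :\: A] have the same nonzero cardinality, with elements below [b] in the first
    and at least [b] in the second. This makes the straightening terminate. *)
Lemma exchange_sum_lt n (A B : {set 'I_n}) b : #|A| = #|B| -> A != B ->
  (forall x, x \in A :\: B -> (x < b)%N) -> (forall x, x \in B -> (b <= x)%N) ->
  (\sum_(x in A) x < \sum_(x in B) x)%N.
Proof.
move=> AB neAB Ab Bb; rewrite (big_setID B) [ltnRHS](big_setID A) /= setIC ltn_add2l.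
have cD : #|A :\: B| = #|B :\: A|.
  by move: AB; rewrite -(cardsID B A) -(cardsID A B) setIC => /addnI.
have D0 : (0 < #|A :\: B|)%N.
  rewrite lt0n; apply: contraNneq neAB => AB0; move: (AB0); rewrite cD => BA0.
  rewrite eqEsubset -!setD_eq0; apply/andP.
  by split; apply/eqP; apply: cards0_eq.
apply: (@leq_trans (\sum_(x in A :\: B) b)); last first.
  rewrite !sum_nat_const cD -sum_nat_const; apply: leq_sum => x.
  by rewrite inE => /andP[_ /Bb].
have [x xAB] : exists x, x \in A :\: B by apply/set0Pn; rewrite -cards_eq0 -lt0n.
rewrite (bigD1 x) // [ltnRHS](bigD1 x) //= -addSn leq_add ?Ab //.
by apply: leq_sum => y /andP[/Ab /ltnW].
Qed.

Lemma mem_take_pseq m n (I : PiMN m n) r x : x \in take r (pseq I) ->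
  exists2 j : 'I_m, (j < r)%N & x = pent I j.
Proof.
move=> /(nthP x)[i]; rewrite size_take_min size_pseq leq_min => /andP[ir im].
by rewrite nth_take // => <-; exists (Ordinal im); rewrite // -(nth_pseq x).
Qed.

Lemma mem_drop_pseq m n (I : PiMN m n) r x : x \in drop r (pseq I) ->
  exists2 j : 'I_m, (r <= j)%N & x = pent I j.
Proof.
move=> /(nthP x)[i]; rewrite size_drop size_pseq ltn_subRL => im.
by rewrite nth_drop => <-; exists (Ordinal im); rewrite ?leq_addr // -(nth_pseq x).
Qed.

Section Straightening.

Variables (k : fieldType) (q : k) (B : algType k) (n m : nat).
Variable X : 'I_n -> 'I_m -> B.
Hypotheses (q0 : q != 0) (qX : qmatrix q X).
Implicit Types I J : PiMN m n.

Definition maxm I : B := minr q X (pseq I) setT.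

Definition std_pair (w : seq 'I_n) (p : PiMN m n * PiMN m n) : bool :=
  (p.1 <= p.2)%O && perm_eq w (pseq p.1 ++ pseq p.2).

Definition std_span (w : seq 'I_n) (x : B) : Prop :=
  exists c : PiMN m n * PiMN m n -> k,
    x = \sum_(p | std_pair w p) c p *: (maxm p.1 * maxm p.2).

Lemma std_span0 w : std_span w 0.
Proof. by exists (fun=> 0); rewrite big1 // => p _; rewrite scale0r. Qed.

Lemma std_spanD w x y : std_span w x -> std_span w y -> std_span w (x + y).
Proof.
move=> [c ->] [d ->]; exists (fun p => c p + d p); rewrite -big_split.
by apply: eq_bigr => p _; rewrite scalerDl.
Qed.

Lemma std_spanZ w a x : std_span w x -> std_span w (a *: x).
Proof.
move=> [c ->]; exists (fun p => a * c p); rewrite scaler_sumr.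
by apply: eq_bigr => p _; rewrite scalerA.
Qed.

Lemma std_span_perm w w' x : perm_eq w w' -> std_span w x -> std_span w' x.
Proof.
move=> ww' [c ->]; exists c; apply: eq_bigl => p.
by rewrite /std_pair (permPl ww').
Qed.

Lemma std_span_std I J : (I <= J)%O -> std_span (pseq I ++ pseq J) (maxm I * maxm J).
Proof.
move=> IJ; exists (fun p => (p == (I, J))%:R).
rewrite (bigD1 (I, J)) /=; last by rewrite /std_pair IJ perm_refl.
by rewrite eqxx scale1r big1 ?addr0 // => p /andP[_ /negPf ->]; rewrite scale0r.
Qed.

Lemma minr_maxm s : size s = m -> minr q X s setT = 0 \/
  exists I, perm_eq (pseq I) s /\ exists c, minr q X s setT = c *: maxm I.
Proof.
move=> sm; have [us|ns] := boolP (uniq s); last first.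
  by left; apply: (minr_nuniq qX q0).
right; have [I Is] := PiMN_of_seq us sm; exists I; split => //.
have [|c _ E] := @minr_perm _ _ _ _ _ _ qX q0 s (pseq I); first by rewrite perm_sym.
by exists c; rewrite E.
Qed.

Lemma minr_span s t (w : seq 'I_n) : perm_eq (s ++ t) w ->
  (forall I J, perm_eq (pseq I) s -> perm_eq (pseq J) t ->
     std_span (pseq I ++ pseq J) (maxm I * maxm J)) ->
  std_span w (minr q X s setT * minr q X t setT).
Proof.
move=> stw IH.
have [sm|sm] := eqVneq (size s) m; last first.
  by rewrite minr_size ?mul0r ?cardsT ?card_ord //; apply: std_span0.
have [tm|tm] := eqVneq (size t) m; last first.
  by rewrite [X in _ * X]minr_size ?mulr0 ?cardsT ?card_ord //; apply: std_span0.
have [->|[I [Is [c ->]]]] := minr_maxm sm; first by rewrite mul0r; apply: std_span0.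
have [->|[J [Jt [d ->]]]] := minr_maxm tm; first by rewrite mulr0; apply: std_span0.
rewrite -scalerAl -scalerAr; do 2!apply: std_spanZ.
apply: std_span_perm (IH I J Is Jt); apply: perm_trans stw.
by apply: perm_cat.
Qed.

(** Induction on the sum of the entries of [I]. If J_a < I_a, the Garnir relation on the entries of
    [I] from position [a] on and those of [J] up to [a] replaces the product by products with a
    smaller first factor. *)
Lemma straighten I J : std_span (pseq I ++ pseq J) (maxm I * maxm J).
Proof.
have [N] := ubnP (\sum_(x <- pseq I) (x : nat)); elim: N I J => // N IH I J IN.
case: (boolP (I <= J)%O) => [|IJ]; first exact: std_span_std.
have [a Ja] : exists a, (pent J a < pent I a)%N.
  apply/existsP; rewrite -[X in is_true X]negbK negb_exists; apply: contra IJ.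
  by move=> /forallP H; apply/PiMN_leP => j; rewrite leqNgt.
set s := pseq I in IN *; set t := pseq J.
pose s1 := take a s; pose s2 := drop a s.
pose t1 := take a.+1 t; pose t2 := drop a.+1 t.
have sE : s = s1 ++ s2 by rewrite cat_take_drop.
have tE : t = t1 ++ t2 by rewrite cat_take_drop.
have sz_s : size s = m := size_pseq I.
have sz_t : size t = m := size_pseq J.
have ltT : transitive (fun i j : 'I_n => (i < j)%N).
  by move=> ? ? ?; apply: ltn_trans.
have am := ltn_ord a.
have t1b x : x \in t1 -> (x <= pent J a)%N.
  by move=> /mem_take_pseq[j ja ->]; rewrite leqNgt pent_mono -leqNgt.
have s2b x : x \in s2 -> (pent I a <= x)%N.
  by move=> /mem_drop_pseq[j ja ->]; rewrite leqNgt pent_mono -leqNgt.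
have sort_s2 : sorted (fun i j : 'I_n => (i < j)%N) s2.
  exact/drop_sorted/pseq_sorted.
have sort_t1 : sorted (fun i j : 'I_n => (i < j)%N) t1.
  exact/take_sorted/pseq_sorted.
pose K0 := [set x in s2]; pose K1 := [set x in t1]; pose K := K0 :|: K1.
have disj x : x \in t1 -> x \in s2 -> False.
  by move=> /t1b xJ /s2b Ix; move: (leq_ltn_trans xJ Ja); rewrite ltnNge Ix.
have KD0 : K :\: K0 = K1.
  apply/setP => x; rewrite !inE; case: (boolP (x \in t1)) => xt; last first.
    by rewrite orbF andNb.
  by rewrite orbT andbT; apply/negP; apply: disj xt.
have enum0 : enum K0 = s2.
  apply: sorted_ltn_eq => //; first exact: enum_set_sorted.
  by move=> x; rewrite mem_enum inE.
have enum1 : enum K1 = t1.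
  apply: sorted_ltn_eq => //; first exact: enum_set_sorted.
  by move=> x; rewrite mem_enum inE.
have K0K : K0 \subset K by apply: subsetUl.
have cardK0 : #|K0| = (m - a)%N by rewrite cardE enum0 size_drop sz_s.
(* There are m - a entries from [I] and a + 1 from [J], just enough for the Garnir relation. *)
have cardK : #|K| = m.+1.
  rewrite -(cardsID K0 K) (setIidPr K0K) KD0 cardK0 [X in (_ + X)%N]cardE enum1.
  by rewrite size_take_min sz_t (minn_idPl am); lia.
have permK (K' : {set 'I_n}) : K' \subset K ->
    perm_eq (enum K' ++ enum (K :\: K')) (enum K).
  move=> K'K; apply: uniq_perm; rewrite ?enum_uniq //.
    rewrite cat_uniq !enum_uniq andbT /=; apply/hasPn => x.
    by rewrite !mem_enum !inE => /andP[].
  move=> x; rewrite mem_cat !mem_enum !inE.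
  by case: (boolP (x \in K')) => // /(subsetP K'K); rewrite !inE.
have mK : (m < #|K|)%N by rewrite cardK.
have := garnir s1 t2 q0 qX mK.
(* The term of [K0] is the original product, up to a power of -q. *)
rewrite (bigD1 K0) //= KD0 enum0 enum1 -sE -tE => /eqP; rewrite addr_eq0 => /eqP.
move/(canRL (scalerK (expf_neq0 _ _))); rewrite oppr_eq0 => /(_ q0).
rewrite -/(maxm I) -/(maxm J) => ->; apply: std_spanZ.
rewrite -sumrN; elim/big_ind: _ => [||K' /andP[K'K K'0]].
- exact: std_span0.
- by move=> ? ?; apply: std_spanD.
rewrite -scaleNr; apply: std_spanZ; apply: minr_span.
  have pK0 := permK K0 K0K; have pK' := permK K' K'K.
  rewrite sE tE -!catA perm_cat2l !catA perm_cat2r.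
  by apply: perm_trans pK' _; rewrite perm_sym -{1}enum0 -{1}enum1 -KD0.
move=> I' J' I'E J'E; apply: IH; move: IN; rewrite ltnS; apply: leq_trans.
rewrite (perm_big _ I'E) sE !big_cat /= ltn_add2l.
rewrite big_enum -enum0 big_enum /=.
apply: (exchange_sum_lt (b := pent I a)) => //.
- have := perm_size I'E; rewrite size_pseq size_cat -cardE size_take_min sz_s.
  by rewrite (minn_idPl (ltnW am)) cardK0 => /(congr1 (subn^~ a)); rewrite addKn => ->.
- move=> x /setDP[xK' xK0]; have := subsetP K'K x xK'.
  by rewrite inE (negPf xK0) inE => /t1b xJ; apply: leq_ltn_trans Ja.
- by move=> x; rewrite inE => /s2b.
Qed.

End Straightening.

(** * Leading terms of minors *)

Section Permutations.

Variable m : nat.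
Implicit Types (s : 'S_m) (i j r : 'I_m).

(** Pigeonhole: the j + 1 indices up to [j] cannot all be sent to the [j] indices below it. *)
Lemma perm_exceeds_low s j : exists2 r : 'I_m, (r <= j)%N & (j <= s r)%N.
Proof.
pose A := [set r : 'I_m | (r <= j)%N]; pose A' := [set r : 'I_m | (r < j)%N].
have AE : A = j |: A'.
  by apply/setP => r; rewrite !inE leq_eqVlt val_eqE.
have jA' : j \notin A' by rewrite inE ltnn.
have : ~~ (s @: A \subset A').
  apply/negP => /subset_leq_card.
  by rewrite (card_imset _ perm_inj) AE cardsU1 jA' ltnn.
case/subsetPn => x /imsetP[r rA ->]; rewrite inE -leqNgt => js.
by exists r; rewrite // inE in rA.
Qed.

Lemma perm_exceeds_high s j : exists2 r : 'I_m, (j <= r)%N & (s r <= j)%N.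
Proof.
have [r rj js] := perm_exceeds_low (s^-1)%g j.
by exists ((s^-1)%g r); rewrite ?permKV.
Qed.

Lemma perm_increasing s : (forall i j, (i < j)%N -> (s i < s j)%N) -> s = 1%g.
Proof.
move=> inc; have E : [seq s j | j <- enum 'I_m] = enum 'I_m.
  have so : sorted (fun i j : 'I_m => (i < j)%N) (enum 'I_m).
    by rewrite -(sorted_map (f := val) (e' := ltn)) val_enum_ord iota_ltn_sorted.
  apply: sorted_ltn_eq => //.
    by rewrite sorted_map; apply: sub_sorted so => i j; apply: inc.
  move=> j; rewrite mem_enum inE; apply/mapP; exists ((s^-1)%g j).
    by rewrite mem_enum.
  by rewrite permKV.
apply/permP => j; rewrite perm1.
by move: E; rewrite -[RHS]map_id => /eq_in_map; apply; rewrite mem_enum.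
Qed.

(** Undoing an inversion increases the sum, so only the identity can be a maximum. *)
Lemma rearrangement_lt (a : 'I_m -> nat) s :
  (forall i j, (i < j)%N -> (a i < a j)%N) -> s != 1%g ->
  (\sum_j a j * s j < \sum_j a j * j)%N.
Proof.
move=> ainc; pose f (t : 'S_m) := (\sum_j a j * t j)%N.
have step t : t != 1%g -> exists t', (f t < f t')%N.
  move=> t1.
  case: (boolP [exists i : 'I_m, [exists j : 'I_m, (i < j)%N && (t j < t i)%N]]).
    case/existsP => i /existsP[j /andP[ij tji]].
    have ne : j != i by rewrite -val_eqE /= gtn_eqF.
    exists (tperm i j * t)%g; rewrite /f (bigD1 i) //= (bigD1 j) //=.
    rewrite [ltnRHS](bigD1 i) //= [X in (_ < _ + X)%N](bigD1 j) //=.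
    rewrite !permM tpermL tpermR !addnA.
    rewrite [X in (_ < _ + X)%N](eq_bigr (fun x => (a x * t x)%N)); last first.
      by move=> x /andP[xi xj]; rewrite permM tpermD // eq_sym.
    by rewrite ltn_add2r; have := ainc _ _ ij; nia.
  move=> ninv; case/eqP: t1; apply: perm_increasing => i j ij.
  move: ninv; rewrite negb_exists => /forallP/(_ i); rewrite negb_exists.
  move=> /forallP/(_ j); rewrite ij /= -leqNgt leq_eqVlt => /orP[/eqP/val_inj|//].
  by move=> /perm_inj ijE; rewrite ijE ltnn in ij.
have [t _ tmax] := arg_maxnP f (isT : xpredT (1%g : 'S_m)).
have t1 : t = 1%g.
  apply/eqP; apply/negPn/negP => /step[t']; rewrite ltnNge => /negP; apply.
  exact: tmax.
move=> /step[t' st']; have -> : (\sum_j a j * j)%N = f t.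
  by rewrite t1 /f; apply: eq_bigr => j _; rewrite perm1.
exact: leq_trans st' (tmax t' isT).
Qed.

End Permutations.

(** * Minors in the band representations *)

Section RepMinors.

Variables (k : fieldType) (n m : nat) (q : k).
Hypothesis q0 : q != 0.
Variables lo hi : nat -> nat.
Hypothesis lo_mono : {homo lo : i j / (i <= j)%N}.
Hypothesis hi_mono : {homo hi : i j / (i <= j)%N}.

Notation op := (@endo k expo k^o).
Notation repX := (@repX k n m q lo hi).
Notation ordle := (@ordle k n m).
Notation lead := (@lead k n m).
Implicit Types I : PiMN m n.

Lemma repX_qmatrix : qmatrix q repX.
Proof.
apply: (@qmatrix_tr k q m n op (fun j i => repX i j)).
by apply: rtt_qmatrix => // j l i h; apply: repX_rtt.
Qed.

Definition in_band I := [forall j : 'I_m, (lo j <= pent I j <= hi j)%N].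

(* The exponent of the diagonal term of the minor I. *)
Definition mexp I : expo := \sum_(j < m) dlt (pent I j) j.

Definition repm I : op := maxm q repX I.

Lemma repmE I : repm I = \sum_(s : 'S_m) (- q) ^+ perm_length s *:
    \prod_(j < m) repX (pent I j) (s j).
Proof. exact: minr_leibniz. Qed.

(** If the entry of [I] in column [j] leaves the band, pigeonhole and monotonicity give, in every
    term of the permutation expansion, a factor that also lies outside the band and is therefore
    zero. *)
Lemma repm0 I : ~~ in_band I -> repm I = 0.
Proof.
rewrite negb_forall => /existsP[j]; rewrite repmE negb_and -!ltnNge => bad.
apply: big1 => s _; suff [r r0] : exists r, repX (pent I r) (s r) = 0.
  have -> : \prod_(j < m) repX (pent I j) (s j) = 0; last by rewrite scaler0.
  have : r \in index_enum 'I_m by apply: mem_index_enum.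
  elim: (index_enum 'I_m) => // x e IH; rewrite inE big_cons.
  by case/orP => [/eqP <-|/IH ->]; rewrite ?r0 ?mul0r ?mulr0.
case/orP: bad => [Ilo|hiI].
  have [r rj jr] := perm_exceeds_low s j; exists r; apply: repX0 => //.
  rewrite negb_and -ltnNge; apply/orP; left.
  have Irj : (pent I r <= pent I j)%N by rewrite leqNgt pent_mono -leqNgt.
  exact: leq_ltn_trans Irj (leq_trans Ilo (lo_mono jr)).
have [r rj jr] := perm_exceeds_high s j; exists r; apply: repX0 => //.
rewrite negb_and -!ltnNge; apply/orP; right.
have Irj : (pent I j <= pent I r)%N by rewrite leqNgt pent_mono -leqNgt.
exact: leq_ltn_trans (hi_mono jr) (leq_trans hiI Irj).
Qed.

Lemma wgt_sum (J : Type) (r : seq J) (F : J -> expo) :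
  wgt n m (\sum_(j <- r) F j) = \sum_(j <- r) wgt n m (F j).
Proof.
elim: r => [|j r IH]; first by rewrite !big_nil wgt0.
by rewrite !big_cons wgtD IH.
Qed.

Lemma wgt_mexp I : wgt n m (mexp I) = (\sum_(j < m) (pent I j).+1 * j)%N%:Z.
Proof.
rewrite wgt_sum (big_morph Posz PoszD (erefl _)); apply: eq_bigr => j _.
by rewrite wgt_dlt.
Qed.

(** By the rearrangement inequality the diagonal term outweighs every other term. *)
Lemma repm_lead I : in_band I -> lead (repm I) (mexp I).
Proof.
move=> /forallP gI; rewrite repmE (bigD1 1%g) //=; apply: leadD.
  apply: leadZ; first by rewrite expf_neq0 // oppr_eq0.
  rewrite /mexp; elim: (index_enum 'I_m) => [|j e IH].
    by rewrite !big_nil; apply: lead1.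
  rewrite !big_cons perm1; apply: leadM => //; apply: repX_lead => //.
apply: ordle_sum => s s1; apply: ordleZ.
have ordX (F : 'I_m -> nat) (e : seq 'I_m) :
    ordle (\prod_(j <- e) repX (pent I j) (s j))
      (\sum_(j <- e) (pent I j).+1 * s j)%N%:Z.
  elim: e => [|j e IH]; first by rewrite !big_nil; apply: ordle1.
  by rewrite !big_cons PoszD; apply: ordleM => //; apply: repX_ord.
apply: ordleW (ordX (fun=> 0%N) _).
rewrite wgt_mexp lerBrDr -[1]/(1%N%:Z) -PoszD lez_nat addn1.
by apply: rearrangement_lt => // i j ij; rewrite ltnS pent_lt.
Qed.

Definition wexp (s : seq (PiMN m n)) : expo := \sum_(I <- s) mexp I.

Lemma repm_word0 s : ~~ all in_band s -> \prod_(I <- s) repm I = 0.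
Proof.
elim: s => //= I s IH; rewrite negb_and big_cons => /orP[/repm0 ->|/IH ->].
  by rewrite mul0r.
by rewrite mulr0.
Qed.

Lemma repm_word_lead s : all in_band s -> lead (\prod_(I <- s) repm I) (wexp s).
Proof.
rewrite /wexp; elim: s => [_|I s IH /= /andP[gI gs]].
  by rewrite !big_nil; apply: lead1.
by rewrite !big_cons; apply: leadM; [apply: repm_lead|apply: IH].
Qed.

Lemma exists_max_int (J : eqType) (S : seq J) (p : pred J) (f : J -> int) j :
  j \in S -> p j -> exists i, [/\ i \in S, p i &
    forall i', i' \in S -> p i' -> f i' <= f i].
Proof.
elim: S j => // x S IH j jS pj.
have [/hasP[y yS py]|/hasPn nS] := boolP (has p S).
  have [i [iS pi imax]] := IH y yS py.
  have [fx|fx] := leP (f x) (f i).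
    exists i; split; rewrite ?inE ?iS ?orbT // => i'; rewrite inE => /orP[/eqP->//|].
    exact: imax.
  have [px|npx] := boolP (p x); last first.
    exists i; split; rewrite ?inE ?iS ?orbT // => i'; rewrite inE.
    by case/orP => [/eqP->|]; [rewrite (negPf npx)|exact: imax].
  exists x; split; rewrite ?mem_head // => i'; rewrite inE => /orP[/eqP->//|i'S pi'].
  exact: le_trans (imax _ i'S pi') (ltW fx).
have xE : x = j.
  by move: jS; rewrite inE => /orP[/eqP->//|/nS]; rewrite pj.
exists x; split; rewrite ?mem_head ?xE // => i'; rewrite inE => /orP[/eqP->//|/nS].
by move=> /negPf ->.
Qed.

(** Applied to the indicator of 0 and evaluated at the exponent of a heaviest band word with nonzero
    coefficient, the sum keeps only the term of that word. *)
Lemma rep_independent (S : seq (seq (PiMN m n))) (c : seq (PiMN m n) -> k) :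
  uniq S -> {in [seq s <- S | all in_band s] &, injective wexp} ->
  \sum_(s <- S) c s *: \prod_(I <- s) repm I = 0 ->
  forall s, s \in S -> all in_band s -> c s = 0.
Proof.
move=> uS injS sum0 s sS gs; apply/eqP/negPn/negP => cs.
pose p s := all in_band s && (c s != 0).
have ps : p s by rewrite /p gs cs.
have [t [tS /andP[gt ct] tmax]] := exists_max_int (fun s => wgt n m (wexp s)) sS ps.
pose u0 : expo -> k^o := fun v => (v == 0)%:R.
have LT0 : LT n m u0 0.
  split=> [|v]; first by rewrite /u0 eqxx oner_neq0.
  by rewrite /u0; have [->|v0] := eqVneq v 0; rewrite /= ?eqxx.
have LTw s' : all in_band s' -> LT n m ((\prod_(I <- s') repm I) u0) (wexp s').
  by move=> gs'; have := repm_word_lead gs' LT0; rewrite addr0.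
have ev (P : op) : P = 0 -> P u0 (wexp t) = 0 by move=> ->.
have evsum (r : seq (seq (PiMN m n))) F : (\sum_(s <- r) F s : op) u0 (wexp t) =
    \sum_(s <- r) (F s : op) u0 (wexp t).
  by elim: r => [|x r IH]; rewrite ?big_nil // !big_cons endoDE IH.
pose val s' : k := (\prod_(I <- s') repm I) u0 (wexp t).
have : \sum_(s' <- S) c s' * val s' = 0.
  by have := ev _ sum0; rewrite evsum.
rewrite (bigD1_seq t) //= [X in _ + X]big1_seq => [|s' /andP[s't s'S]].
  rewrite addr0 => /eqP; apply/negP; rewrite mulf_neq0 //.
  exact: (LTw t gt).1.
have [gs'|ngs'] := boolP (all in_band s'); last first.
  by rewrite /val repm_word0 // endo0E mulr0.
have [cs'|cs'] := eqVneq (c s') 0; first by rewrite cs' mul0r.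
have [->|nz] := eqVneq (val s') 0; first by rewrite mulr0.
have wne : wexp t != wexp s'.
  apply: contraNneq s't => /injS ts'; apply/eqP; rewrite ts' ?mem_filter ?gs' ?gt //.
have := (LTw s' gs').2 _ nz wne.
by rewrite ltNge tmax // /p gs' cs'.
Qed.

End RepMinors.

Lemma minr_morph (k : fieldType) (q : k) (B B' : algType k) n m
    (phi : {lrmorphism B -> B'}) (X : 'I_n -> 'I_m -> B) s T :
  phi (minr q X s T) = minr q (fun i j => phi (X i j)) s T.
Proof.
elim: s T => [|i s IH] T /=; first by rewrite rmorph_nat.
rewrite linear_sum; apply: eq_bigr => j _.
by rewrite linearZ /= rmorphM /= IH.
Qed.

(** * Exponents of words of minors *)

Section WordExponents.

Variables m n : nat.
Implicit Types (s t : seq (PiMN m n)) (I J : PiMN m n).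

Lemma wexpE s (i : 'I_n) (j : 'I_m) :
  wexp s (i : nat, j : nat) = (count (fun I => pent I j == i) s)%:Z.
Proof.
elim: s => [|I s IH] /=; rewrite /wexp ?big_nil ?big_cons //.
rewrite PoszD -IH; congr (_ + _); rewrite /mexp fct_sumE (bigD1 j) //= big1.
  by rewrite addr0 /dlt xpair_eqE eqxx andbT eq_sym val_eqE; case: eqP.
move=> j' /negPf jj'; rewrite /dlt xpair_eqE andbC.
by rewrite eq_sym -val_eqE /= in jj'; rewrite jj'.
Qed.

Lemma wexp_perm s t (j : 'I_m) : wexp s = wexp t ->
  perm_eq [seq pent K j | K <- s] [seq pent K j | K <- t].
Proof.
move=> st; rewrite /perm_eq; apply/allP => i _; apply/eqP.
rewrite !count_map; have := congr1 (fun v : expo => v (i : nat, j : nat)) st.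
by rewrite /= !wexpE => -[].
Qed.

(** The exponent records the multiset of [j]-th entries for each [j], and in a sorted word these
    entries increase, so they are recovered in order. Since m > 0, some column compares the
    lengths. *)
Lemma wexp_sorted_inj s t : (0 < m)%N -> sorted <=%O s -> sorted <=%O t ->
  wexp s = wexp t -> s = t.
Proof.
move=> m0 ss st stE.
have mapE (j : 'I_m) : [seq pent K j | K <- s] = [seq pent K j | K <- t].
  have mono r : sorted <=%O r ->
      sorted (fun x y : 'I_n => (x <= y)%N) [seq pent K j | K <- r].
    move=> sr; rewrite sorted_map; apply: sub_sorted sr => I J /PiMN_leP; exact.
  apply: (@sorted_eq _ (fun x y : 'I_n => (x <= y)%N)); last exact: wexp_perm.
  - by move=> x y z; apply: leq_trans.
  - by move=> x y; rewrite -eqn_leq => /eqP/val_inj.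
  - exact: mono.
  - exact: mono.
have sz : size s = size t.
  by have := congr1 size (mapE (Ordinal m0)); rewrite !size_map.
case: s => [|I0 s'] in ss stE mapE sz *; first by apply/esym/size0nil.
apply: (@eq_from_nth _ I0) => // i si; apply: pent_inj => j.
have := congr1 (fun r => nth (pent I0 j) r i) (mapE j).
by rewrite !(nth_map I0) -?sz.
Qed.

Lemma wexp_meet_join I J :
  wexp [:: Order.meet I J; Order.join I J] = wexp [:: I; J].
Proof.
rewrite /wexp !big_cons !big_nil !addr0 /mexp -!big_split; apply: eq_bigr => j _ /=.
rewrite pent_meet pent_join /minn /maxn; case: ltnP => // _.
exact: addrC.
Qed.

Lemma pseq_meet_join I J :
  perm_eq (pseq (Order.meet I J) ++ pseq (Order.join I J)) (pseq I ++ pseq J).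
Proof.
have mj (j : 'I_m) : perm_eq [:: pent (Order.meet I J) j; pent (Order.join I J) j]
                             [:: pent I j; pent J j].
  case: (leqP (pent I j) (pent J j)) => IJ.
    have -> : pent (Order.meet I J) j = pent I j.
      by apply: val_inj; rewrite /= pent_meet; apply/minn_idPl.
    have -> // : pent (Order.join I J) j = pent J j.
    by apply: val_inj; rewrite /= pent_join; apply/maxn_idPr.
  have -> : pent (Order.meet I J) j = pent J j.
    by apply: val_inj; rewrite /= pent_meet; apply/minn_idPr/ltnW.
  have -> : pent (Order.join I J) j = pent I j.
    by apply: val_inj; rewrite /= pent_join; apply/maxn_idPl/ltnW.
  by apply/permPl/(perm_catC [:: pent J j] [:: pent I j]).
rewrite !pseqE; elim: (enum 'I_m) => //= j e IH.
have swap x y (r r' : seq 'I_n) : perm_eql (x :: r ++ y :: r') ([:: x; y] ++ r ++ r').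
  apply/permPl; rewrite /= perm_cons -[y :: r']/([:: y] ++ r').
  by rewrite perm_catCA.
by rewrite swap perm_sym swap perm_sym; apply: perm_cat.
Qed.

End WordExponents.

Section Bounds.

Variables m n : nat.
Implicit Types I J : PiMN m n.

(** Bands are bounded by functions on all natural numbers; the value [n] past the last column keeps
    this one monotone. *)
Definition pbound I (j : nat) : nat :=
  if insub j is Some j' then pent I (j' : 'I_m) else n.

Lemma pboundE I (j : 'I_m) : pbound I j = pent I j.
Proof. by rewrite /pbound valK. Qed.

Lemma pbound_mono I : {homo pbound I : i j / (i <= j)%N}.
Proof.
move=> i j ij; rewrite /pbound; case: (insubP _ j) => [j' jm jj'|_]; last first.
  by case: insubP => [i' _ _|_] //; apply/ltnW/ltn_ord.
rewrite insubT; first exact: leq_ltn_trans ij jm.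
by move=> im; rewrite leqNgt pent_mono -leqNgt /= jj'.
Qed.

End Bounds.

(** * The quadratic relations *)

Section QuadraticRelations.

Variables (k : fieldType) (m n : nat) (q : k).
Hypotheses (q0 : q != 0) (m0 : (0 < m)%N).
Implicit Types I J : PiMN m n.

Notation M := (@qminor k m n q).

Lemma qminorE I : M I = maxm q (@Xq k n m q) I.
Proof. by rewrite /maxm minr_leibniz. Qed.

(** The universal property carries a relation between minors to the band representation. *)
Lemma minor_words_independent lo hi (S : seq (seq (PiMN m n)))
    (c : seq (PiMN m n) -> k) :
  {homo lo : i j / (i <= j)%N} -> {homo hi : i j / (i <= j)%N} -> uniq S ->
  {in [seq s <- S | all (in_band lo hi) s] &, injective (@wexp n m)} ->
  \sum_(s <- S) c s *: \prod_(I <- s) M I = 0 ->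
  forall s, s \in S -> all (in_band lo hi) s -> c s = 0.
Proof.
move=> lo_mono hi_mono uS injS sum0.
apply: (rep_independent q0 lo_mono hi_mono uS injS).
have qR := @repX_qmatrix k n m q q0 lo hi.
have := congr1 (OqM_lift qR) sum0; rewrite linear0 linear_sum.
apply: etrans; apply: eq_bigr => s _; rewrite linearZ /= rmorph_prod; congr (_ *: _).
apply: eq_bigr => I _; rewrite qminorE /repm /maxm; apply: esym.
apply: etrans (minr_morph q (OqM_lift qR) _ _ _) _.
congr (minr q _ _ _); apply/funext => i; apply/funext => j.
exact: OqM_liftX.
Qed.

Definition pair_word (p : PiMN m n * PiMN m n) : seq (PiMN m n) := [:: p.1; p.2].

Lemma pair_word_inj : injective pair_word.
Proof. by move=> [I J] [I' J'] [-> ->]. Qed.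

Lemma pair_word_sorted p : (p.1 <= p.2)%O -> sorted <=%O (pair_word p).
Proof. by case: p => I J /= ->. Qed.

Lemma prod_pair_word p : \prod_(I <- pair_word p) M I = M p.1 * M p.2.
Proof. by rewrite !big_cons big_nil mulr1. Qed.

Definition pair_of_word (s : seq (PiMN m n)) (p0 : PiMN m n * PiMN m n) :=
  (nth p0.1 s 0, nth p0.2 s 1).

(* In the band representation the words not in the band vanish and the others have
   distinct leading exponents, except that [:: I; J] shares its exponent with the
   standard pair formed by the meet and the join. *)
Lemma straightening_vanishing lo hi I J (c : PiMN m n * PiMN m n -> k) :
  {homo lo : i j / (i <= j)%N} -> {homo hi : i j / (i <= j)%N} ->
  M I * M J = \sum_(p | std_pair (pseq I ++ pseq J) p) c p *: (M p.1 * M p.2) ->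
  ~~ (I <= J)%O -> ~~ (in_band lo hi I && in_band lo hi J) \/
    c (Order.meet I J, Order.join I J) = 0 ->
  (forall p, std_pair (pseq I ++ pseq J) p -> in_band lo hi p.1 -> in_band lo hi p.2 ->
    c p = 0) /\ ~~ (in_band lo hi I && in_band lo hi J).
Proof.
move=> lo_mono hi_mono E IJ H; set std := std_pair _ in E *.
(* Only nonzero coefficients are kept, so the pair of the meet and the join drops out when [c]
   vanishes there. *)
pose P := [seq p <- enum {: PiMN m n * PiMN m n} | std p && (c p != 0)].
pose S := [:: I; J] :: map pair_word P.
(* With coefficient -1 on [[:: I; J]] the straightening becomes a linear dependence among the words
   of [S]. *)
pose d s := if s == [:: I; J] then - 1 else c (pair_of_word s (I, J)).
have memP p : p \in P = std p && (c p != 0) by rewrite mem_filter mem_enum andbT.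
have dp p : p \in P -> d (pair_word p) = c p.
  rewrite memP => /andP[/andP[pp _] _]; rewrite /d /pair_word; case: eqP => [[e1 e2]|_].
    by rewrite e1 e2 (negPf IJ) in pp.
  by case: p pp.
have uP : uniq P by rewrite filter_uniq ?enum_uniq.
have uS : uniq S.
  rewrite cons_uniq (map_inj_uniq pair_word_inj) uP andbT.
  apply/mapP => -[p]; rewrite memP => /andP[/andP[pp _] _] [e1 e2].
  by rewrite -e1 -e2 (negPf IJ) in pp.
have sortP s : s \in map pair_word P -> sorted <=%O s.
  case/mapP => p; rewrite memP => /andP[/andP[pp _] _] ->; exact: pair_word_sorted.
have sum0 : \sum_(s <- S) d s *: \prod_(K <- s) M K = 0.
  rewrite big_cons {1}/d eqxx scaleN1r !big_cons big_nil mulr1 E.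
  rewrite big_map addrC (eq_big_seq (fun p => c p *: (M p.1 * M p.2))); last first.
    by move=> p pP; rewrite dp // prod_pair_word.
  rewrite big_filter big_enum_cond /= [X in _ - X](bigID (fun p => c p != 0)) /=.
  rewrite [X in _ - (_ + X)]big1 ?addr0 ?subrr // => p /andP[_ /negPn/eqP ->].
  by rewrite scale0r.
have inj : {in [seq s <- S | all (in_band lo hi) s] &, injective (@wexp n m)}.
  have wIJ s : s \in map pair_word P -> in_band lo hi I -> in_band lo hi J ->
      wexp s <> wexp [:: I; J].
    move=> sP gI gJ; rewrite -wexp_meet_join => /wexp_sorted_inj sE.
    have {}sE : s = pair_word (Order.meet I J, Order.join I J).
      apply: sE => //; [exact: sortP|].
      by rewrite /= andbT; apply: le_trans (leIl _ _) (leUl _ _).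
    move: sP; rewrite sE mem_map; last exact: pair_word_inj.
    rewrite memP => /andP[_]; case: H => [|->]; first by rewrite gI gJ.
    by rewrite eqxx.
  move=> s t; rewrite !mem_filter => /andP[gs sS] /andP[gt tS].
  move: sS tS; rewrite !inE => /orP[/eqP sE|sS] /orP[/eqP tE|tS].
  - by rewrite sE tE.
  - move: gs; rewrite sE /= => /and3P[gI gJ _] /esym.
    by move/(wIJ _ tS gI gJ).
  - move: gt; rewrite tE /= => /and3P[gI gJ _].
    by move/(wIJ _ sS gI gJ).
  - by apply: wexp_sorted_inj => //; apply: sortP.
have ind := minor_words_independent lo_mono hi_mono uS inj sum0.
split=> [p sp g1 g2|].
  apply/eqP/negPn/negP => cp; have pP : p \in P by rewrite memP sp.
  case/eqP: cp; rewrite -dp //; apply: ind; rewrite /= ?g1 ?g2 //.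
  by rewrite inE map_f ?orbT.
(* In the band, the coefficient -1 of [[:: I; J]] would have to vanish. *)
apply/negP => /andP[gI gJ]; have := ind [:: I; J]; rewrite mem_head /= gI gJ.
move=> /(_ isT isT); rewrite /d eqxx => /eqP.
by rewrite oppr_eq0 oner_eq0.
Qed.

Lemma pent_le I : forall j, (pent I j <= n)%N.
Proof. by move=> j; apply/ltnW/ltn_ord. Qed.

Lemma in_band_lower I J : in_band (pbound I) (fun=> n) J = (I <= J)%O.
Proof.
apply/forallP/PiMN_leP => H j; first by have := H j; rewrite pboundE => /andP[].
by rewrite pboundE H pent_le.
Qed.

Lemma in_band_upper I J : in_band (fun=> 0%N) (pbound I) J = (J <= I)%O.
Proof.
apply/forallP/PiMN_leP => H j; first by have := H j; rewrite pboundE.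
by rewrite pboundE H.
Qed.

(** If I <= J fails, let [p] have a nonzero coefficient. In the band above [p.1] the standard pair
    [p] survives, so [I] and [J] must survive too, that is, [p.1] is below both; the band below
    [p.2] is dual. In the full band no minor vanishes, which forces a nonzero coefficient on the
    meet and the join. *)
Lemma minor_product_std I J :
  exists c : PiMN m n * PiMN m n -> k,
  [/\ M I * M J = \sum_(p | std_pair (pseq I ++ pseq J) p) c p *: (M p.1 * M p.2),
      forall p, std_pair (pseq I ++ pseq J) p -> c p != 0 ->
        (p.1 <= Order.meet I J)%O && (Order.join I J <= p.2)%O &
      c (Order.meet I J, Order.join I J) != 0].
Proof.
have [IJ|IJ] := boolP (I <= J)%O.
  have [-> ->] : Order.meet I J = I /\ Order.join I J = J.
    by split; [apply/meet_idPl|apply/join_idPr].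
  exists (fun p => (p == (I, J))%:R); split; last by rewrite eqxx oner_eq0.
    rewrite (bigD1 (I, J)) /=; last by rewrite /std_pair IJ perm_refl.
    by rewrite eqxx scale1r big1 ?addr0 // => p /andP[_ /negPf ->]; rewrite scale0r.
  by move=> p _; have [->|_] := eqVneq p (I, J); rewrite ?eqxx // !lexx.
have [c] := straighten q0 (@Xq_qmatrix k n m q) I J.
rewrite -!qminorE => E0.
have {E0} E : M I * M J = \sum_(p | std_pair (pseq I ++ pseq J) p) c p *: (M p.1 * M p.2).
  by rewrite E0; apply: eq_bigr => p _; rewrite -!qminorE.
have cst_mono c0 : {homo (fun=> c0 : nat) : i j / (i <= j)%N} by [].
exists c; split => // [p sp cp|].
  rewrite lexI leUx; have lowP : (p.1 <= I)%O && (p.1 <= J)%O.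
    apply/negPn/negP; rewrite -!in_band_lower => ng.
    have [V _] := straightening_vanishing (@pbound_mono _ _ p.1) (cst_mono n) E
      IJ (or_introl ng).
    case/eqP: cp; apply: V => //; rewrite in_band_lower ?lexx //.
    by case/andP: sp.
  rewrite lowP; apply/negPn/negP; rewrite -!in_band_upper => ng.
  have [V _] := straightening_vanishing (cst_mono 0%N) (@pbound_mono _ _ p.2) E
    IJ (or_introl ng).
  case/eqP: cp; apply: V => //; rewrite in_band_upper ?lexx //.
  by case/andP: sp.
apply/eqP => c0.
have [_] := straightening_vanishing (cst_mono 0%N) (cst_mono n) E IJ (or_intror c0).
case/negP; apply/andP.
by split; apply/forallP => j; apply: pent_le.
Qed.

End QuadraticRelations.

(** * The grading and condition (C) *)

Section ContentEmbedding.

Variables m n : nat.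
Implicit Types I J : PiMN m n.

Definition content_emb I : m.-tupleprod nat := [tuple (pent I i).+1 | i < m].

Lemma tnth_content_emb I i : tnth (content_emb I) i = (pent I i).+1.
Proof. by rewrite tnth_mktuple. Qed.

Lemma content_embE I : content_emb I = [seq (nat_of_ord i).+1 | i <- pseq I] :> seq nat.
Proof. by rewrite pseqE -map_comp. Qed.

Lemma content_emb_same I J p :
  perm_eq (pseq I ++ pseq J) (pseq p.1 ++ pseq p.2) ->
  same_content content_emb I J p.
Proof.
by move=> /(perm_map (fun i : 'I_n => i.+1)); rewrite !map_cat -!content_embE.
Qed.

(** The chains have n + 1 elements rather than n, so that there are at least two even when n = 1. *)
Lemma content_embP :
  increasing_chain_embedding [tuple n.+1 | i < m] content_emb.
Proof.
split.
- move=> I J IJ; apply: pent_inj => j; apply: val_inj => /=.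
  have := congr1 (fun t : m.-tuple nat => tnth t j) IJ.
  by rewrite /= !tnth_content_emb => -[].
- move=> I J; apply: eq_from_tnth => j; rewrite tnth_meet !tnth_content_emb pent_meet.
  by case: leP; rewrite ?leEnat ?ltEnat /=; lia.
- move=> I J; apply: eq_from_tnth => j; rewrite tnth_join !tnth_content_emb pent_join.
  by case: leP; rewrite ?leEnat ?ltEnat /=; lia.
- by move=> I j; rewrite tnth_content_emb tnth_mktuple ltn0Sn ltnS ltnW.
- move=> I; rewrite content_embE sorted_map.
  by apply: sub_sorted (pseq_sorted I) => i j /= /ltnW.
Qed.

End ContentEmbedding.

(** * Degrees in the quantum matrix algebra *)

Section Homogeneity.

Variables (k : fieldType) (n m : nat) (q : k).

Notation OqM := (OqM n m q).

(* The degree is read off a representation that multiplies by x while shifting an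
   integer variable by the degree of x. *)
Definition degX (i : 'I_n) (j : 'I_m) : @endo k int OqM := wshift (fun=> Xq q i j) 1.

Lemma degX_qmatrix : qmatrix q degX.
Proof.
have X := @Xq_qmatrix k n m q.
split=> [i j l jl|i h j ih|i h j l ih jl|i h j l ih jl]; rewrite /degX !wshiftM ?wshiftZ.
- by rewrite (qm_row X i jl).
- by rewrite (qm_col X j ih).
- by rewrite (qm_anti X ih jl).
- by rewrite (qm_diag X ih jl); apply: endo_ext => u t; rewrite endoDE !wshiftE mulrDl.
Qed.

Definition homog (d : int) (x : OqM) : Prop :=
  OqM_lift degX_qmatrix x = wshift (fun=> x) d.

Lemma homog0 d : homog d 0.
Proof.
by rewrite /homog linear0; apply: endo_ext => u t; rewrite endo0E wshiftE mul0r.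
Qed.

Lemma homogL d c x y : homog d x -> homog d y -> homog d (c *: x + y).
Proof.
rewrite /homog linearP /= => -> ->; apply: endo_ext => u t.
by rewrite endoDE endoZE !wshiftE mulrDl scalerAl.
Qed.

Lemma homog1 : homog 0 1.
Proof.
rewrite /homog rmorph1; apply: endo_ext => u t.
by rewrite endo1E wshiftE mul1r subr0.
Qed.

Lemma homogM d d' x y : homog d x -> homog d' y -> homog (d + d') (x * y).
Proof. by rewrite /homog rmorphM /= => -> ->; rewrite wshiftM. Qed.

Lemma homogX i j : homog 1 (Xq q i j).
Proof. exact: OqM_liftX. Qed.

Lemma homog_sum (J : finType) (P : pred J) (F : J -> OqM) d :
  (forall j, P j -> homog d (F j)) -> homog d (\sum_(j | P j) F j).
Proof.
move=> HF; elim/big_ind: _ => // [|x y xd yd]; first exact: homog0.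
by rewrite -[x]scale1r; apply: homogL.
Qed.

Lemma homogZ d c x : homog d x -> homog d (c *: x).
Proof. by move=> xd; rewrite -[c *: x]addr0; apply: homogL => //; apply: homog0. Qed.

Lemma homog_prod (J : Type) (r : seq J) (F : J -> OqM) (d : nat) :
  (forall j, homog d%:Z (F j)) -> homog (d * size r)%N%:Z (\prod_(j <- r) F j).
Proof.
move=> HF; elim: r => [|j r IH]; first by rewrite big_nil muln0; apply: homog1.
by rewrite big_cons /= mulnS PoszD; apply: homogM.
Qed.

Lemma homog_qminor I : homog m%:Z (qminor q I).
Proof.
apply: homog_sum => s _; apply: homogZ.
have := homog_prod (index_enum 'I_m) (fun j => homogX (tnth (PiMN_val I) j) (s j)).
by rewrite mul1n /index_enum -enumT -cardE card_ord.
Qed.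

(** Applied to the indicator of 0 and evaluated at d e, the lift of the sum keeps only the component
    [e], because d > 0 separates the multiples of [d]. *)
Lemma homog_direct (N d : nat) (h : nat -> OqM) : (0 < d)%N ->
  (forall e, homog (d * e)%N%:Z (h e)) -> \sum_(e < N) h e = 0 ->
  forall e, (e < N)%N -> h e = 0.
Proof.
move=> d0 hh sum0 e eN.
pose u : int -> OqM := fun t => (t == 0)%:R.
have := congr1 (fun x => OqM_lift degX_qmatrix x u (d * e)%N%:Z) sum0.
rewrite /= linear0 endo0E linear_sum.
have -> (F : 'I_N -> @endo k int OqM) t : (\sum_(i < N) F i) u t = \sum_(i < N) F i u t.
  by elim/big_rec2: _ => // i x y _ <-.
rewrite (bigD1 (Ordinal eN)) //= [X in _ + X]big1 => [|i ie].
  by rewrite hh wshiftE subrr /u eqxx mulr1 addr0.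
rewrite hh wshiftE /u subr_eq0 eqz_nat eqn_pmul2l //.
by rewrite -val_eqE /= eq_sym in ie; rewrite (negPf ie) mulr0.
Qed.

End Homogeneity.

(** * The quantum Grassmannian and its two families of relations *)

Section Grassmannian.

Variables (k : fieldType) (m n : nat) (q : k).
Hypotheses (q0 : q != 0) (m0 : (0 < m)%N).

Notation Oq := (OqG m n q).
Notation minor := (@OqG_minor k m n q).
Notation deg := (@OqG_degree k m n q).
Notation val := (@OqG_val k m n q).
Implicit Types a b : PiMN m n.

Lemma val_inj_OqG (x y : Oq) : val x = val y -> x = y.
Proof. exact: val_inj. Qed.

Lemma OqG_valD (x y : Oq) : val (x + y) = val x + val y.
Proof. exact: (rmorphD \val). Qed.

Lemma OqG_val0 : val 0 = 0.
Proof. exact: (rmorph0 \val). Qed.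

Lemma OqG_valM (x y : Oq) : val (x * y) = val x * val y.
Proof. exact: (rmorphM \val). Qed.

Lemma OqG_val1 : val 1 = 1.
Proof. exact: (rmorph1 \val). Qed.

Lemma OqG_valZ c (x : Oq) : val (c *: x) = c *: val x.
Proof. exact: GRing.valZ. Qed.

Lemma OqG_val_sum (J : Type) (r : seq J) (P : pred J) (F : J -> Oq) :
  val (\sum_(j <- r | P j) F j) = \sum_(j <- r | P j) val (F j).
Proof. exact: (big_morph val OqG_valD OqG_val0). Qed.

Lemma OqG_val_word (s : seq (PiMN m n)) :
  val (\prod_(a <- s) minor a) = \prod_(a <- s) qminor q a.
Proof. exact: (big_morph val OqG_valM OqG_val1). Qed.

Lemma OqG_degree_word s : deg (size s) (\prod_(a <- s) minor a).
Proof.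
exists (fun t => (t == in_tuple s)%:R).
rewrite (bigD1 (in_tuple s)) //= eqxx scale1r [X in _ + X]big1 ?addr0 // => t /negPf ->.
by rewrite scale0r.
Qed.

Lemma OqG_degree0 e : deg e 0.
Proof. by exists (fun=> 0); rewrite big1 // => t _; rewrite scale0r. Qed.

Lemma OqG_degreeL e c x y : deg e x -> deg e y -> deg e (c *: x + y).
Proof.
move=> [f ->] [g ->]; exists (fun t => c * f t + g t).
rewrite scaler_sumr -big_split; apply: eq_bigr => t _.
by rewrite scalerA scalerDl.
Qed.

Lemma OqG_degree_sum e (J : Type) (r : seq J) (P : pred J) (F : J -> Oq) :
  (forall j, P j -> deg e (F j)) -> deg e (\sum_(j <- r | P j) F j).
Proof.
move=> HF; elim/big_ind: _ => // [|x y xd yd]; first exact: OqG_degree0.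
by rewrite -[x]scale1r; apply: OqG_degreeL.
Qed.

Lemma OqG_degreeZ e c x : deg e x -> deg e (c *: x).
Proof.
by move=> xd; rewrite -[c *: x]addr0; apply: OqG_degreeL => //; apply: OqG_degree0.
Qed.

Lemma OqG_degreeM e f x y : deg e x -> deg f y -> deg (e + f) (x * y).
Proof.
move=> [c ->] [d ->]; rewrite mulr_suml; apply: OqG_degree_sum => t _.
rewrite mulr_sumr; apply: OqG_degree_sum => u _.
rewrite -scalerAl -scalerAr; do 2!apply: OqG_degreeZ.
by have := OqG_degree_word (t ++ u); rewrite size_cat !size_tuple big_cat.
Qed.

Lemma OqG_degree_direct (N : nat) (h : nat -> Oq) :
  (forall e, deg e (h e)) -> \sum_(e < N) h e = 0 ->
  forall e, (e < N)%N -> h e = 0.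
Proof.
move=> hdeg sum0 e eN; apply: val_inj_OqG; rewrite OqG_val0.
(* A product of [e] minors has degree m e in the generators of the matrix algebra. *)
apply: (@homog_direct k n m q N m (fun e => val (h e)) m0 _ _ e eN).
  move=> {e eN} e; have [c ->] := hdeg e; rewrite OqG_val_sum.
  apply: homog_sum => t _; rewrite OqG_valZ; apply: homogZ.
  rewrite OqG_val_word; have := homog_prod t (@homog_qminor k n m q).
  by rewrite size_tuple.
by rewrite -OqG_val_sum sum0 OqG_val0.
Qed.

(** A subalgebra of [OqG] containing the minors has as image in the matrix algebra a subalgebra
    containing them, hence all of [OqG_pred]. *)
Lemma OqG_generated (x : Oq) : x \in subalg_gen (fun y => exists a, y = minor a).
Proof.
apply/asboolP => S [S1 SL SM] Sm.
pose S' : {pred OqM n m q} := fun z => `[< exists2 y, y \in S & val y = z >].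
have /asboolP/(_ S') H : val x \in @OqG_pred k m n q by case: x.
suff /asboolW[y yS /val_inj_OqG <- //] : val x \in S'.
apply: H => [|r [a ->]]; last first.
  by apply/asboolP; exists (minor a) => //; apply: Sm; exists a.
split=> [|c u v|u v].
- by apply/asboolP; exists 1; rewrite ?OqG_val1.
- move=> /asboolP[y yS <-] /asboolP[z zS <-]; apply/asboolP.
  by exists (c *: y + z); [exact: SL|rewrite OqG_valD OqG_valZ].
- move=> /asboolP[y yS <-] /asboolP[z zS <-]; apply/asboolP.
  by exists (y * z); [exact: SM|rewrite OqG_valM].
Qed.

Definition word_span (x : Oq) : Prop := exists S : seq (k * seq (PiMN m n)),
  x = \sum_(p <- S) p.1 *: \prod_(a <- p.2) minor a.

Lemma OqG_word_span x : word_span x.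
Proof.
pose S : {pred Oq} := fun y => `[< word_span y >].
have /asboolP/(_ S) H := OqG_generated x.
suff /asboolW : x \in S by [].
apply: H => [|r [a ->]]; last first.
  apply/asboolP; exists [:: (1, [:: a])].
  by rewrite big_seq1 /= big_seq1 scale1r.
split=> [|c u v|u v].
- apply/asboolP; exists [:: (1, [::])].
  by rewrite big_seq1 /= big_nil scale1r.
- move=> /asboolW[su ->] /asboolW[sv ->]; apply/asboolP.
  exists ([seq (c * p.1, p.2) | p <- su] ++ sv).
  rewrite big_cat big_map scaler_sumr; congr (_ + _).
  by apply: eq_bigr => p _; rewrite scalerA.
- move=> /asboolW[su ->] /asboolW[sv ->]; apply/asboolP.
  exists [seq (p.1 * r.1, p.2 ++ r.2) | p <- su, r <- sv].
  rewrite big_allpairs_dep mulr_suml; apply: eq_bigr => p _.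
  rewrite mulr_sumr; apply: eq_bigr => r _ /=.
  by rewrite big_cat -scalerAl -scalerAr scalerA.
Qed.

Lemma OqG_degree_decomposition x : exists (N : nat) (h : nat -> Oq),
  (forall e, deg e (h e)) /\ x = \sum_(e < N) h e.
Proof.
have [S ->] := OqG_word_span x.
exists (\max_(p <- S) size p.2).+1.
exists (fun e => \sum_(p <- S | size p.2 == e) p.1 *: \prod_(a <- p.2) minor a).
split=> [e|].
  apply: OqG_degree_sum => p /eqP <-.
  exact/OqG_degreeZ/OqG_degree_word.
rewrite (exchange_big_dep xpredT) //= big_seq [RHS]big_seq; apply: eq_bigr => p pS.
have pN : (size p.2 < (\max_(p <- S) size p.2).+1)%N.
  by rewrite ltnS; apply: (leq_bigmax_seq (F := fun p : k * seq (PiMN m n) => size p.2)).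
by rewrite (big_pred1 (Ordinal pN)) // => e; rewrite eq_sym.
Qed.

Lemma OqG_is_grading : is_grading deg.
Proof.
split; first exact: OqG_degree0.
- exact: OqG_degreeL.
- by have := OqG_degree_word [::]; rewrite big_nil.
- exact: OqG_degreeM.
- exact: OqG_degree_decomposition.
- exact: OqG_degree_direct.
Qed.

Lemma OqG_minors_independent : std_independent minor.
Proof.
move=> S c uS sS sum0 s sSs.
have cst_mono c0 : {homo (fun=> c0 : nat) : i j / (i <= j)%N} by [].
have allg r : all (in_band (fun=> 0%N) (fun=> n) : pred (PiMN m n)) r.
  by apply/allP => a _; apply/forallP => j; exact: pent_le.
apply: (minor_words_independent q0 (cst_mono 0%N) (cst_mono n) uS) => //.
  rewrite (eq_filter (a2 := xpredT)) ?filter_predT // => u v uSS vSS.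
  by apply: wexp_sorted_inj => //; apply: sS.
have := congr1 val sum0; rewrite OqG_val0 OqG_val_sum; apply: etrans.
by apply: eq_bigr => r _; rewrite OqG_valZ OqG_val_word.
Qed.

Lemma straddling_sum_std a b (d : PiMN m n * PiMN m n -> k) :
  (forall p, d p != 0 -> std_pair (pseq a ++ pseq b) p /\ straddles a b p) ->
  val (straddling_sum minor a b d) =
    \sum_(p | std_pair (pseq a ++ pseq b) p) d p *: (qminor q p.1 * qminor q p.2).
Proof.
move=> dP; rewrite OqG_val_sum big_mkcond [RHS]big_mkcond; apply: eq_bigr => p _.
rewrite OqG_valZ OqG_valM; have [->|/dP[-> ->//]] := eqVneq (d p) 0.
by rewrite !scale0r !if_same.
Qed.

Lemma std_pair_meet_join a b :
  std_pair (pseq a ++ pseq b) (Order.meet a b, Order.join a b).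
Proof.
rewrite /std_pair perm_sym pseq_meet_join andbT.
exact: le_trans (leIl _ _) (leUl _ _).
Qed.

Lemma meet_join_straddles a b p : (p.1 <= Order.meet a b)%O ->
  (Order.join a b <= p.2)%O -> p.1 != Order.meet a b -> p.2 != Order.join a b ->
  straddles a b p.
Proof.
move=> pm jp pnm pnj; rewrite /straddles.
have lt1 : (p.1 < Order.meet a b)%O by rewrite lt_neqAle pnm.
have lt2 : (Order.join a b < p.2)%O by rewrite lt_neqAle eq_sym pnj.
by rewrite (lt_le_trans lt1) ?leIl // (lt_le_trans lt1) ?leIr //
  (le_lt_trans _ lt2) ?leUl // (le_lt_trans _ lt2) ?leUr.
Qed.

(** Equality of contents with the pair (meet, join) lets one component determine the other. *)
Lemma std_pair_extreme a b p : std_pair (pseq a ++ pseq b) p ->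
  (p.1 == Order.meet a b) = (p.2 == Order.join a b).
Proof.
move=> /andP[_]; rewrite -(permPl (pseq_meet_join a b)) => pp.
apply/eqP/eqP => E; apply: pseq_perm_inj; rewrite perm_sym.
  by move: pp; rewrite E perm_cat2l.
by move: pp; rewrite E perm_cat2r.
Qed.

Lemma OqG_straightening a b : (a >< b)%O -> exists c,
  [/\ straightening_relation minor a b c,
      c (Order.meet a b, Order.join a b) != 0 &
      forall p, c p != 0 -> std_pair (pseq a ++ pseq b) p].
Proof.
move=> ab; have [c [E cP c0]] := minor_product_std q0 m0 a b.
pose d p := if std_pair (pseq a ++ pseq b) p then c p else 0.
have dP p : d p != 0 -> std_pair (pseq a ++ pseq b) p /\ c p != 0.
  by rewrite /d; case: ifP => //; rewrite eqxx.
exists d; split; last by move=> p /dP[].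
  apply: val_inj_OqG; rewrite OqG_valM E straddling_sum_std.
    by apply: eq_bigr => p sp; rewrite /d sp.
  move=> p /dP[sp cp]; split=> //; have /andP[pm jp] := cP p sp cp.
  have leIJ : (a <= b)%O = false by apply/negP => /le_comparable; apply/negP.
  have leJI : (b <= a)%O = false by apply/negP => /ge_comparable; apply/negP.
  have pa : (p.1 <= a)%O := le_trans pm (leIl _ _).
  have pb : (p.1 <= b)%O := le_trans pm (leIr _ _).
  have ap : (a <= p.2)%O := le_trans (leUl _ _) jp.
  have bp : (b <= p.2)%O := le_trans (leUr _ _) jp.
  rewrite /straddles !lt_neqAle pa pb ap bp !andbT.
  (* An equality between a component of [p] and [a] or [b] would make [a] and [b] comparable. *)
  apply/and4P; split; apply/eqP => pE.
  - by rewrite -pE pb in leIJ.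
  - by rewrite -pE pa in leJI.
  - by move: bp; rewrite -pE leJI.
  - by move: ap; rewrite -pE leIJ.
by rewrite /d std_pair_meet_join.
Qed.

Lemma OqG_commutation a b : exists qab d,
  [/\ qab != 0, commutation_relation minor a b qab d,
      d (Order.meet a b, Order.join a b) = 0 &
      forall p, d p != 0 -> std_pair (pseq a ++ pseq b) p].
Proof.
have [c [E cP c0]] := minor_product_std q0 m0 a b.
have [c' [E' cP' c0']] := minor_product_std q0 m0 b a.
rewrite meetC joinC in c0' cP'.
(* Both coefficients are nonzero, and their ratio cancels the pair (meet, join) in the difference of
   the two straightenings. *)
pose qab := c (Order.meet a b, Order.join a b) / c' (Order.meet a b, Order.join a b).
have stdC (p : PiMN m n * PiMN m n) :
    std_pair (pseq b ++ pseq a) p = std_pair (pseq a ++ pseq b) p.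
  by rewrite /std_pair perm_catC.
pose d p := if std_pair (pseq a ++ pseq b) p then c p - qab * c' p else 0.
have d0 : d (Order.meet a b, Order.join a b) = 0.
  by rewrite /d std_pair_meet_join /qab divfK // subrr.
have dP p : d p != 0 -> std_pair (pseq a ++ pseq b) p.
  by rewrite /d; case: ifP => //; rewrite eqxx.
exists qab, d; split => //; first by rewrite mulf_neq0 ?invr_eq0.
apply: val_inj_OqG; rewrite straddling_sum_std.
  have valB (x y : Oq) : val (x - y) = val x - val y by exact: (rmorphB \val).
  rewrite valB OqG_valZ !OqG_valM E E' (eq_bigl _ _ stdC) scaler_sumr -sumrB.
  by apply: eq_bigr => p sp; rewrite /d sp scalerBl scalerA.
move=> p dp; have sp := dP p dp; split=> //.
have /andP[pm jp] : (p.1 <= Order.meet a b)%O && (Order.join a b <= p.2)%O.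
  have [cp|/(cP p sp)//] := eqVneq (c p) 0.
  have [cp'|] := eqVneq (c' p) 0; last by apply: cP'; rewrite stdC.
  by case/eqP: dp; rewrite /d sp cp cp' mulr0 subrr.
(* If [p.1] were the meet, [p] would be the pair (meet, join), where [d] vanishes; so both
   components are strict and [p] straddles. *)
have pn : p.1 != Order.meet a b.
  apply: contraNneq dp => pE; rewrite -d0; apply/eqP; congr d.
  have /eqP jE : p.2 == Order.join a b by rewrite -(std_pair_extreme sp) pE eqxx.
  by rewrite -pE -jE; case: (p).
by apply: meet_join_straddles; rewrite // -(std_pair_extreme sp).
Qed.

End Grassmannian.

Theorem theorem5p1p6 (k : fieldType) (m n : nat) (q : k) :
  (0 < m)%N -> (m <= n)%N -> q != 0 ->
  symmetric_quantum_graded_ASL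
    (@OqG_minor k m n q) (@OqG_degree k m n q) /\
  condition_C (@OqG_minor k m n q).
Proof.
move=> m0 mn q0; split.
  split.
  - exact: OqG_is_grading.
  - move=> a; exists 1%N => //; have := OqG_degree_word q [:: a].
    by rewrite big_seq1.
  - exact: OqG_generated.
  - exact: OqG_minors_independent.
  - by move=> a b /(OqG_straightening q0 m0)[c [cE _ _]]; exists c.
  - move=> a b; have [qab [d [qab0 dE _ _]]] := OqG_commutation q0 m0 a b.
    by exists qab, d.
exists m, [tuple n.+1 | i < m], (@content_emb m n); split => //.
- by move=> i; rewrite tnth_mktuple ltnS (leq_trans m0).
- exact: content_embP.
- move=> a b /(OqG_straightening q0 m0)[c [cE c0 cP]]; exists c; split => //.
  by move=> p _ /cP/andP[_]; apply: content_emb_same.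
- move=> a b; have [qab [d [qab0 dE d0 dP]]] := OqG_commutation q0 m0 a b.
  exists qab, d; split => // p _ /dP/andP[_]; exact: content_emb_same.
Qed.
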